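(* Let $1\le j\le k\le n$. For every $v\in\mathrm{Conv}(\mathbb R^n;\mathbb R)$, $$\operatorname{supp}\mathrm{MA}(v[k],h_{B^n}[n-k];\cdot)\subseteq\operatorname{supp}\mathrm{MA}(v[j],h_{B^n}[n-j];\cdot).$$
   Context: $\mathrm{Conv}(\mathbb R^n;\mathbb R)$ is the set of convex functions $v:\mathbb R^n\to\mathbb R$. For such $v$, the Monge–Ampère measure is $\mathrm{MA}(v;B)=V_n(\bigcup_{b\in B}\partial v(b))$ for Borel $B$, where $\partial v$ is the subdifferential and $V_n$ Lebesgue measure. The mixed Monge–Ampère measure $\mathrm{MA}(w_1,\dots,w_n;\cdot)$ is the unique family, symmetric in its entries, with $\mathrm{MA}(\lambda_1v_1+\dots+\lambda_mv_m;\cdot)=\sum_{i_1,\dots,i_n=1}^m\lambda_{i_1}\cdots\lambda_{i_n}\mathrm{MA}(v_{i_1},\dots,v_{i_n};\cdot)$ for $v_i\in\mathrm{Conv}(\mathbb R^n;\mathbb R)$, $\lambda_i\ge0$; $w[k]$ means $w$ repeated $k$ times. $h_{B^n}(x)=|x|$. $\operatorname{supp}$ is the support of a measure. *)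

(* Defs.v *)
From HB Require Import structures.
From mathcomp Require Import all_boot all_order all_algebra all_fingroup.
From mathcomp Require Import all_classical all_reals all_analysis.
Set Implicit Arguments. Unset Strict Implicit. Unset Printing Implicit Defensive.
Import Order.TTheory GRing.Theory Num.Theory.
Import numFieldNormedType.Exports.
Local Open Scope classical_set_scope.
Local Open Scope ring_scope.

Notation borelRV R n := (g_sigma_algebraType (@open 'rV[R]_n)).

Section MA.
Variables (R : realType) (n : nat).

Definition dotp (x y : 'rV[R]_n) : R := \sum_(i < n) x ord0 i * y ord0 i.

(* Euclidean norm; h_{B^n}(x) = |x| is the support function of the unit ball. *)
Definition h_ball (x : 'rV[R]_n) : R := Num.sqrt (dotp x x).

Definition convex_fun (v : 'rV[R]_n -> R) : Prop :=
  forall (x y : 'rV[R]_n) (t : R), 0 <= t -> t <= 1 ->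
    v (t *: x + (1 - t) *: y) <= t * v x + (1 - t) * v y.

Definition subdiff (v : 'rV[R]_n -> R) (b : 'rV[R]_n) : set 'rV[R]_n :=
  [set y | forall x : 'rV[R]_n, v b + dotp y (x - b) <= v x].

Definition box (a b : 'rV[R]_n) : set 'rV[R]_n :=
  [set x | forall i : 'I_n, a ord0 i <= x ord0 i <= b ord0 i].
Definition box_vol (a b : 'rV[R]_n) : R :=
  \prod_(i < n) Num.max 0 (b ord0 i - a ord0 i).

Definition lebesgue_outer (A : set 'rV[R]_n) : \bar R :=
  ereal_inf [set s : \bar R | exists a b : nat -> 'rV[R]_n,
     A `<=` \bigcup_k box (a k) (b k) /\
     s = (\sum_(0 <= k <oo) (box_vol (a k) (b k))%:E)%E].

Definition MA (v : 'rV[R]_n -> R) (B : set 'rV[R]_n) : \bar R :=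
  lebesgue_outer (\bigcup_(b in B) subdiff v b).


Definition is_mixed_MA
  (M : ('I_n -> 'rV[R]_n -> R) -> {measure set (borelRV R n) -> \bar R}) : Prop :=
  (forall (w : 'I_n -> 'rV[R]_n -> R) (s : {perm 'I_n}),
      (forall i, convex_fun (w i)) -> M (w \o s) = M w) /\
  (forall (m : nat) (vs : 'I_m -> 'rV[R]_n -> R) (lam : 'I_m -> R),
      (forall i, convex_fun (vs i)) -> (forall i, 0 <= lam i) ->
      forall B : set (borelRV R n), measurable B ->
        MA (fun x => \sum_(i < m) lam i * vs i x) B =
        (\sum_(f : {ffun 'I_n -> 'I_m})
            (\prod_(l < n) lam (f l))%:E * M (fun l => vs (f l)) B)%E).

Definition supp (mu : {measure set (borelRV R n) -> \bar R}) : set 'rV[R]_n :=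
  [set x | forall U : set 'rV[R]_n, open U -> U x -> (0 < mu U)%E].

Definition rep_ball (k : nat) (w : 'rV[R]_n -> R) : 'I_n -> 'rV[R]_n -> R :=
  fun i => if (i < k)%N then w else h_ball.

End MA.

(* Main.v *)
(* Let h be the Euclidean norm and M_k = M(v[k], h[n-k]). Polarization makes
   mixed Monge-Ampere measures multilinear and local. Two convex functions that
   agree near the boundary of a ball have the same gradient image of the ball, so
   the mixed mass of the ball is unchanged when an entry is modified inside; a
   gluing argument then gives semicontinuity of the mass in each entry.

   Since h is a uniform limit of maxima of linear forms, and a suitable sum of
   functions |<p, .>| minus such a maximum is convex, M_k > 0 near x0 yields
   linear forms f_i with M(v[k], |f_1|, ..., |f_(n-k)|) > 0 near x0. That measure
   lives on the subspace F where all f_i vanish, so v restricted to F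
   touches an affine function on a compact set near x0, at some b in F.
   Conversely, a multiple of h minus an ellipsoidal norm close to |p| is convex,
   so M_j = 0 near x0 implies M(v[j], |p_1|, ..., |p_(n-j)|) = 0 there for all
   p_i. Choosing the p_i to cut out a j-dimensional E in F through b, and adding a
   large multiple of sum |p_i| to v, one can modify v near b into a polyhedral
   function, for which that mass is the volume of a parallelepiped. *)

Require Import Defs.
From HB Require Import structures.
From mathcomp Require Import all_boot all_order all_algebra all_fingroup.
From mathcomp Require Import all_classical all_reals all_analysis.
From mathcomp Require Import measurable_realfun ring lra.
Import Order.TTheory GRing.Theory Num.Theory.
Import numFieldNormedType.Exports.
Set Implicit Arguments.
Unset Strict Implicit.
Unset Printing Implicit Defensive.
Local Open Scope classical_set_scope.
Local Open Scope ring_scope.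

(** * The outer measure of boxes *)

(** The limit arguments transport only the vanishing of masses of balls, not their values, and each
    of them costs some radius; hence the pairs [r < r'] and the fifths of a radius at the end.
    Passing from [k] to [j] works because isolated contact is inherited by subspaces: a strict
    inequality at the points of a sphere in F holds in particular at those in E. The bound [1 <= j]
    leaves room for [b] in E. A second obstacle is that [MA] is only an outer measure of a gradient
    image. Its additivity on disjoint sets is borrowed from the measures [M w], through the
    expansion of [MA] of a sum; subtracting masses then requires finiteness, hence the bounded
    sets. *)

Section OuterMeasure.
Variable R : realType.

Let vol n (a b : nat -> R) : R := \prod_(i < n) Num.max 0 (b i - a i).

Let vol_ge0 n a b : 0 <= vol n a b.
Proof. by apply: prodr_ge0 => i _; rewrite le_max lexx. Qed.

(* Induction on the dimension: slice along the last coordinate [t], so that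
   integrating the lower-dimensional bound over [t] gives the bound. *)
Lemma vol_le_cover n (a b : nat -> nat -> R) (D : nat -> bool)
    (al be : nat -> R) :
  (forall x : nat -> R, (forall i, (i < n)%N -> al i <= x i <= be i) ->
     exists2 k, D k & forall i, (i < n)%N -> a k i <= x i <= b k i) ->
  ((vol n al be)%:E <= \sum_(0 <= k <oo) ((D k)%:R * vol n (a k) (b k))%:E)%E.
Proof.
elim: n D => [|n IH] D cov.
  have [//|k Dk _] := cov al.
  have s0 i : (0 <= ((D i)%:R * vol 0 (a i) (b i))%:E)%E.
    by rewrite lee_fin mulr_ge0.
  have := @nneseries_lim_ge R (fun k => ((D k)%:R * vol 0 (a k) (b k))%:E)
     xpredT 0%N k.+1 (fun i _ _ => s0 i).
  apply: le_trans; rewrite big_nat_recr //= /vol !big_ord0 Dk mulr1.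
  by rewrite leeDr //; apply: sume_ge0 => i _; exact: s0.
pose mu := @lebesgue_measure R.
pose f k (t : R) : \bar R :=
  (((D k)%:R * vol n (a k) (b k)) * \1_`[a k n, b k n]%classic t)%:E.
have c0 k : 0 <= (D k)%:R * vol n (a k) (b k) by rewrite mulr_ge0.
have f0 k t : (0 <= f k t)%E by rewrite lee_fin mulr_ge0.
have mf k : measurable_fun (setT : set (measurableTypeR R)) (f k).
  apply/measurable_EFinP; apply: measurable_funM => //.
have itvE x y : mu `[x, y]%classic = (Num.max 0 (y - x))%:E.
  rewrite /mu lebesgue_measure_itv /= lte_fin; case: ltP => xy.
    by rewrite -EFinB; congr (_%:E); apply/esym/max_idPr; rewrite subr_ge0 ltW.
  by congr (_%:E); apply/esym/max_idPl; rewrite subr_le0.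
have intZ c x y : 0 <= c ->
    (\int[mu]_t (c * \1_`[x, y]%classic t)%:E)%E = (c * Num.max 0 (y - x))%:E.
  move=> c_ge0.
  have := @integralZl_indic _ _ _ mu _ measurableT (fun=> `[x, y]%classic) c.
  rewrite /= => -> //; last by rewrite ltNge c_ge0.
  by rewrite integral_indic // setIT EFinM -itvE.
have -> : (\sum_(0 <= k <oo) ((D k)%:R * vol n.+1 (a k) (b k))%:E =
           \int[mu]_t \sum_(0 <= k <oo) f k t)%E.
  rewrite integral_nneseries //; apply: eq_eseriesr => k _.
  by rewrite intZ // /vol big_ord_recr /= mulrA.
have -> : (vol n.+1 al be)%:E =
    (\int[mu]_t (vol n al be * \1_`[al n, be n]%classic t)%:E)%E.
  by rewrite intZ // /vol big_ord_recr.
apply: ge0_le_integral => //.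
- by move=> t _; rewrite lee_fin mulr_ge0.
- by apply/measurable_EFinP; apply: measurable_funM.
- by apply: ge0_emeasurable_sum => //.
move=> t _; rewrite indicE.
have [tin|] := boolP (t \in _); last first.
  by rewrite mulr0 => _; apply: nneseries_ge0 => k _ _; exact: f0.
rewrite mulr1.
(* Only the boxes whose last side contains [t] cover the slice at [t]; the selection [D] is in the
   statement so that the induction can discard the others. *)
pose D' k := D k && (a k n <= t <= b k n).
have -> : (\sum_(0 <= k <oo) f k t =
           \sum_(0 <= k <oo) ((D' k)%:R * vol n (a k) (b k))%:E)%E.
  apply: eq_eseriesr => k _; rewrite /f /D' indicE; congr (_%:E).
  rewrite mulrAC -natrM mulnb; congr (_ %:R * _); congr (nat_of_bool (_ && _)).
  by apply/idP/idP; rewrite inE /= in_itv.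
apply: IH => x hx.
have [i ltin|k Dk hk] := cov (fun i => if i == n then t else x i).
  case: eqP => [->|/eqP ne]; first by move: tin; rewrite inE /= in_itv.
  by apply: hx; rewrite ltn_neqAle ne -ltnS.
exists k.
  by rewrite /D' Dk /=; have := hk n (ltnSn n); rewrite eqxx.
move=> i ltin; have := hk i (ltnW ltin).
by rewrite (ltn_eqF ltin).
Qed.

Variable n : nat.
Implicit Types (A B : set 'rV[R]_n) (a b x : 'rV[R]_n).

Lemma lebesgue_outer_ge0 A : (0 <= lebesgue_outer A)%E.
Proof.
apply/ereal_infP => _ [a [b [_ ->]]]; apply: nneseries_ge0 => k _ _.
by rewrite lee_fin; apply: prodr_ge0 => i _; rewrite le_max lexx.
Qed.

Lemma lebesgue_outer_translate_le (p : 'rV[R]_n) A :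
  (lebesgue_outer [set (x + p)%R | x in A] <= lebesgue_outer A)%E.
Proof.
apply: ereal_inf_le_tmp => _ [a [b [Aab ->]]].
exists (fun k => a k + p), (fun k => b k + p); split.
  move=> _ [x Ax <-]; have [k _ kx] := Aab _ Ax; exists k => // i.
  by rewrite !mxE !lerD2r.
apply: eq_eseriesr => k _; congr (_%:E); apply: eq_bigr => i _.
by rewrite !mxE opprD addrACA subrr addr0.
Qed.

Lemma lebesgue_outer_translate (p : 'rV[R]_n) A :
  lebesgue_outer [set x + p | x in A] = lebesgue_outer A.
Proof.
apply/eqP; rewrite eq_le lebesgue_outer_translate_le /=.
have {1}-> : A = [set x - p | x in [set x + p | x in A]].
  apply/seteqP; split=> [x Ax|_ [_ [x Ax <-] <-]]; last by rewrite addrK.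
  by exists (x + p); rewrite ?addrK//; exists x.
exact: lebesgue_outer_translate_le.
Qed.

(** One cube covers [A]; the rest of the sequence is padded with the box from 0 to 0. In dimension 0
    that box has volume 1, the empty product, and the series would diverge. *)
Lemma lebesgue_outer_fin (n_gt0 : (0 < n)%N) A (C : R) :
  (forall x, A x -> `|x| <= C) -> (lebesgue_outer A < +oo)%E.
Proof.
move=> hC.
pose a k : 'rV[R]_n := if k is 0%N then const_mx (- C) else 0.
pose b k : 'rV[R]_n := if k is 0%N then const_mx C else 0.
apply: (@le_lt_trans _ _ (\sum_(0 <= k <oo) (box_vol (a k) (b k))%:E)%E).
  apply: ereal_inf_lbound; exists a, b; split=> //.
  move=> x Ax; exists 0%N => // i; rewrite !mxE -ler_norml.
  apply: le_trans (hC _ Ax); rewrite /Num.Def.normr /= mx_normrE.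
  exact: (le_bigmax _ (fun ij => `|x ij.1 ij.2|) (ord0, i)).
rewrite nneseries_recl //; last first.
  by move=> k _; rewrite lee_fin; apply: prodr_ge0 => i _; rewrite le_max lexx.
rewrite eseries0 ?adde0 ?ltry // => -[//|k] _ _.
rewrite /box_vol /a /b (bigD1 (Ordinal n_gt0)) //= mxE subrr maxxx mul0r.
by [].
Qed.

Lemma lebesgue_outer_box_gt0 A (c : R) : 0 < c ->
  (forall x, (forall i, `|x ord0 i| <= c) -> A x) -> (0 < lebesgue_outer A)%E.
Proof.
move=> c0 hA.
pose ext x (i : nat) : R := if insub i is Some j then x ord0 j else 0.
have extE x (i : 'I_n) : ext x i = x ord0 i.
  by rewrite /ext insubT //= => h; congr (x _ _); apply: val_inj.
apply: (@lt_le_trans _ _ (vol n (fun=> - c) (fun=> c))%:E).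
  rewrite lte_fin; apply: prodr_gt0 => i _.
  by rewrite lt_max opprK addr_gt0 ?orbT.
apply/ereal_infP => _ [a [b [Aab ->]]].
have -> : (\sum_(0 <= k <oo) (box_vol (a k) (b k))%:E =
   \sum_(0 <= k <oo) ((xpredT k)%:R * vol n (ext (a k)) (ext (b k)))%:E)%E.
  apply: eq_eseriesr => k _; congr (_%:E); rewrite mul1r.
  by apply: eq_bigr => i _; rewrite !extE.
apply: vol_le_cover => x hx.
have [k _ hk] : (\bigcup_k box (a k) (b k)) (\row_i x i).
  by apply/Aab/hA => i; rewrite mxE ler_norml hx.
exists k => // i ltin.
by have := hk (Ordinal ltin); rewrite mxE -(extE (a k)) -(extE (b k)).
Qed.

End OuterMeasure.

(** * Convex functions on row vectors *)

Section ConvexFunctions.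
Variables (R : realType) (n : nat).
Implicit Types (x y z p b : 'rV[R]_n) (f g v w : 'rV[R]_n -> R).

Lemma dotpC x y : dotp x y = dotp y x.
Proof. by apply: eq_bigr => i _; rewrite mulrC. Qed.

Lemma dotpDr p x y : dotp p (x + y) = dotp p x + dotp p y.
Proof. by rewrite -big_split; apply: eq_bigr => i _; rewrite mxE mulrDr. Qed.

Lemma dotpZr p (c : R) x : dotp p (c *: x) = c * dotp p x.
Proof. by rewrite mulr_sumr; apply: eq_bigr => i _; rewrite mxE mulrCA. Qed.

Lemma dotpNr p x : dotp p (- x) = - dotp p x.
Proof. by rewrite -scaleN1r dotpZr mulN1r. Qed.

Lemma dotpBr p x y : dotp p (x - y) = dotp p x - dotp p y.
Proof. by rewrite dotpDr dotpNr. Qed.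

Lemma dotpDl p x y : dotp (x + y) p = dotp x p + dotp y p.
Proof. by rewrite !(dotpC _ p) dotpDr. Qed.

Lemma dotpZl p (c : R) x : dotp (c *: x) p = c * dotp x p.
Proof. by rewrite !(dotpC _ p) dotpZr. Qed.

Lemma dotpNl p x : dotp (- x) p = - dotp x p.
Proof. by rewrite !(dotpC _ p) dotpNr. Qed.

Lemma dotpBl p x y : dotp (x - y) p = dotp x p - dotp y p.
Proof. by rewrite !(dotpC _ p) dotpBr. Qed.

Lemma dotp0r p : dotp p 0 = 0.
Proof. by rewrite -[0](scale0r 0) dotpZr mul0r. Qed.

Lemma dotp0l p : dotp 0 p = 0.
Proof. by rewrite dotpC dotp0r. Qed.

Lemma dotp_ge0 x : 0 <= dotp x x.
Proof. by apply: sumr_ge0 => i _; rewrite -expr2 sqr_ge0. Qed.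

Lemma dotp_eq0 x : dotp x x = 0 -> x = 0.
Proof.
move/eqP; rewrite psumr_eq0; last by move=> i _; rewrite -expr2 sqr_ge0.
move/allP => h; apply/rowP => i; rewrite mxE.
by have := h i (mem_index_enum i); rewrite /= mulf_eq0 orbb => /eqP.
Qed.

Lemma coord_le_norm x i : `|x ord0 i| <= `|x|.
Proof.
rewrite {2}/Num.Def.normr /= mx_normrE.
exact: (le_bigmax _ (fun ij => `|x ij.1 ij.2|) (ord0, i)).
Qed.

Lemma norm_le_coord x (c : R) :
  0 <= c -> (forall i, `|x ord0 i| <= c) -> `|x| <= c.
Proof.
move=> c0 h; rewrite /Num.Def.normr /= mx_normrE.
by apply: bigmax_le => // -[i j] _ /=; rewrite ord1.
Qed.

(** All differences of norms below are proved convex by exhibiting subgradients, which avoids second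
    derivatives. *)
Lemma convex_of_subgradient f :
  (forall x, exists p, forall z, f x + dotp p (z - x) <= f z) -> convex_fun f.
Proof.
move=> h x y t t0 t1; set m := _ + _; have [p hp] := h m.
have t1' : 0 <= 1 - t by rewrite subr_ge0.
have := ler_wpM2l t0 (hp x); have := ler_wpM2l t1' (hp y).
have : t * dotp p (x - m) + (1 - t) * dotp p (y - m) = 0.
  by rewrite !dotpBr /m dotpDr !dotpZr; ring.
by rewrite !mulrDr; lra.
Qed.

Lemma convex_affine p (c : R) : convex_fun (fun x => dotp p x + c).
Proof.
by apply: convex_of_subgradient => x; exists p => z; rewrite dotpBr; lra.
Qed.

Lemma convex_add f g : convex_fun f -> convex_fun g ->
  convex_fun (fun x => f x + g x).
Proof.
move=> hf hg x y t t0 t1;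
  apply: le_trans (lerD (hf x y t t0 t1) (hg x y t t0 t1)) _.
by rewrite !mulrDr addrACA.
Qed.

Lemma convex_scale (c : R) f : 0 <= c -> convex_fun f ->
  convex_fun (fun x => c * f x).
Proof.
move=> c0 hf x y t t0 t1; apply: le_trans (ler_wpM2l c0 (hf x y t t0 t1)) _.
by rewrite mulrDr !(mulrCA c).
Qed.

Lemma convex_cst (c : R) : convex_fun (fun _ : 'rV[R]_n => c).
Proof. by move=> x y t t0 t1; rewrite -mulrDl addrCA subrr addr0 mul1r. Qed.

Lemma convex_sum (I : Type) (s : seq I) (P : pred I) (F : I -> 'rV[R]_n -> R) :
  (forall i, P i -> convex_fun (F i)) ->
  convex_fun (fun x => \sum_(i <- s | P i) F i x).
Proof.
move=> h x y t t0 t1; rewrite !mulr_sumr -big_split /=.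
by apply: ler_sum => i Pi; apply: h.
Qed.

Lemma convex_max f g : convex_fun f -> convex_fun g ->
  convex_fun (fun x => Num.max (f x) (g x)).
Proof.
move=> hf hg x y t t0 t1; have t1' : 0 <= 1 - t by rewrite subr_ge0.
rewrite ge_max; apply/andP; split.
  apply: le_trans (hf _ _ _ t0 t1) _.
  by rewrite lerD ?ler_wpM2l // le_max lexx.
apply: le_trans (hg _ _ _ t0 t1) _.
by rewrite lerD ?ler_wpM2l // le_max lexx orbT.
Qed.

Lemma convex_abs_affine p (c : R) : convex_fun (fun x => `|dotp p x + c|).
Proof.
have -> : (fun x => `|dotp p x + c|) =
    (fun x => Num.max (dotp p x + c) (dotp (- p) x + (- c))).
  by apply/funext => x; rewrite dotpNl -opprD maxrN.
by apply: convex_max; exact: convex_affine.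
Qed.

Lemma convex_dist z : convex_fun (fun x => `|x - z|).
Proof.
move=> x y t t0 t1.
have -> : t *: x + (1 - t) *: y - z = t *: (x - z) + (1 - t) *: (y - z).
  rewrite !scalerBr addrACA -opprD -scalerDl addrCA subrr addr0.
  by rewrite scale1r.
apply: le_trans (ler_normD _ _) _.
by rewrite !normrZ !ger0_norm ?subr_ge0.
Qed.

(** Induction on the number [m] of coordinates that may be nonzero: [x] is the midpoint of a point
    of the new axis and of twice its remaining part, which explains the radius [2 * D] in the
    induction hypothesis. On the axis, the two ends of a segment dominate. *)
Lemma convex_bounded_above v (C : R) : convex_fun v ->
  exists K, forall x, `|x| <= C -> v x <= K.
Proof.
move=> cv.
suff H m : (m <= n)%N -> forall C, exists K, forall x,
    (forall i : 'I_n, (m <= i)%N -> x ord0 i = 0) -> `|x| <= C -> v x <= K.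
  have [K hK] := H n (leqnn n) C; exists K => x; apply: hK => i.
  by rewrite leqNgt ltn_ord.
elim: m => [_ D|m IH ltmn D].
  exists (v 0) => x x0 _; suff -> : x = 0 by [].
  by apply/rowP => i; rewrite mxE x0.
have [K hK] := IH (ltnW ltmn) (2 * D).
pose e : 'rV[R]_n := delta_mx ord0 (Ordinal ltmn).
pose E := Num.max D 1.
have E0 : 0 < E by rewrite lt_max ltr01 orbT.
exists (2^-1 * Num.max (v ((2 * E) *: e)) (v ((- (2 * E)) *: e)) + 2^-1 * K).
move=> x x0 xD; set t := x ord0 (Ordinal ltmn).
have tE : `|t| <= E by rewrite le_max (le_trans (coord_le_norm _ _) xD).
pose x' := x - t *: e.
have xE : x = 2^-1 *: ((2 * t) *: e) + (1 - 2^-1) *: (2 *: x').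
  rewrite !scalerA (_ : (1 - 2^-1) * 2 = 1); last by lra.
  by rewrite (_ : 2^-1 * (2 * t) = t) ?scale1r /x' ?subrKC//; lra.
have x'i i : x' ord0 i = if val i == m then 0 else x ord0 i.
  rewrite /x' /e !mxE eqxx andTb; case: (val i =P m) => [im|ne].
    rewrite (_ : i == _) ?mulr1; last by apply/eqP/val_inj.
    by rewrite /t (_ : Ordinal ltmn = i) ?subrr//; apply: val_inj.
  rewrite (_ : i == _ = false) ?mulr0 ?subr0//.
  by apply/eqP => ie; apply: ne; rewrite ie.
have D0 : 0 <= D by apply: le_trans xD.
have half : 1 - 2^-1 = 2^-1 :> R by lra.
have h0 : 0 <= 2^-1 :> R by rewrite invr_ge0 ler0n.
have h1 : 2^-1 <= 1 :> R by rewrite -subr_ge0 half.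
rewrite {1}xE half; have := cv ((2 * t) *: e) (2 *: x') _ h0 h1.
rewrite half => /le_trans; apply.
apply: lerD; apply: ler_wpM2l => //.
- pose s := (2 * t + 2 * E) / (4 * E).
  have E4 : 0 < 4 * E by lra.
  have /andP[tE1 tE2] : - E <= t <= E by rewrite -ler_norml.
  have s0 : 0 <= s by apply: divr_ge0; lra.
  have s1 : s <= 1 by rewrite ler_pdivrMr //; lra.
  have -> : (2 * t) *: e = s *: ((2 * E) *: e) + (1 - s) *: ((- (2 * E)) *: e).
    rewrite !scalerA -scalerDl; congr (_ *: _); rewrite /s; field.
    by rewrite gt_eqF.
  apply: le_trans (cv _ _ _ s0 s1) _.
  set M := Num.max _ _.
  have -> : M = s * M + (1 - s) * M by ring.
  by rewrite lerD ?ler_wpM2l ?subr_ge0// le_max lexx ?orbT.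
- apply: hK => [i mi|].
    rewrite mxE x'i; case: eqP => [|/eqP ne]; rewrite ?mulr0// x0 ?mulr0//.
    by rewrite ltn_neqAle eq_sym ne.
  rewrite normrZ ger0_norm ?ler_wpM2l//.
  apply: norm_le_coord => // i; rewrite x'i; case: ifP => _.
    by rewrite normr0.
  exact: le_trans (coord_le_norm _ _) xD.
Qed.

Lemma convex_bounded v (C : R) : convex_fun v ->
  exists2 K, 0 <= K & forall x, `|x| <= C -> `|v x| <= K.
Proof.
move=> cv; have [K hK] := convex_bounded_above C cv.
exists (`|K| + 2 * `|v 0|) => [|x xC]; first by rewrite addr_ge0 ?mulr_ge0.
have h1 := hK _ xC; have := hK (- x); rewrite normrN => /(_ xC) h2.
(* The lower bound comes from reflection: [v 0] is at most the mean of [v x] and [v (- x)]. *)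
have := cv x (- x) 2^-1; rewrite (_ : 1 - 2^-1 = 2^-1 :> R); last by lra.
rewrite -scalerDr subrr scaler0 => /(_ _ _)/wrap[]; [lra|lra|] => h3.
have := ler_norm K; have := ler_norm (- v 0); rewrite normrN => h4 h5.
have h6 := ler_norm (v 0).
by rewrite ler_norml; apply/andP; split; lra.
Qed.

Lemma convex_lipschitz v (C : R) : convex_fun v ->
  exists2 L, 0 <= L &
    forall x y, `|x| <= C -> `|y| <= C -> `|v x - v y| <= L * `|x - y|.
Proof.
move=> cv; have [K K0 hK] := convex_bounded (C + 1) cv.
exists (2 * K) => [|x0 y0 x0C y0C]; first by rewrite mulr_ge0.
suff H x y : `|x| <= C -> `|y| <= C -> v x - v y <= 2 * K * `|x - y|.
  rewrite ler_norml lerNl opprB; apply/andP; split; last exact: H.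
  by rewrite -normrN opprB; apply: H.
move=> xC yC; have [->|xy] := eqVneq x y.
  by rewrite !subrr normr0 mulr0.
set d := `|x - y|; have d0 : 0 < d by rewrite normr_gt0 subr_eq0.
(* The segment from [y] to [x] is prolonged by a unit length; convexity bounds the slope before [x]
   by the one up to [z], where [v] is still bounded by [K]. *)
pose z := x + d^-1 *: (x - y).
have zC : `|z| <= C + 1.
  apply: le_trans (ler_normD _ _) _; rewrite lerD // normrZ ger0_norm.
    by rewrite mulVf ?gt_eqF.
  by rewrite invr_ge0 ltW.
pose s := d / (1 + d).
have d1 : 0 < 1 + d by rewrite addr_gt0.
have s0 : 0 <= s by rewrite divr_ge0 // ltW.
have s1 : s <= 1 by rewrite ler_pdivrMr //; lra.
have sd : s <= d by rewrite ler_pdivrMr // ler_peMr ?ltW//; lra.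
have E : x = s *: z + (1 - s) *: y.
  apply/rowP => i; rewrite !mxE /s; field.
  by rewrite !gt_eqF.
have := cv z y s s0 s1; rewrite -E => h1.
have := hK _ zC; rewrite ler_norml => /andP[h2 h3].
have : `|v y| <= K by apply: hK; lra.
rewrite ler_norml => /andP[h4 h5].
have h6 : s * (v z - v y) <= s * (2 * K) by apply: ler_wpM2l => //; lra.
have h7 : s * (2 * K) <= d * (2 * K) by apply: ler_wpM2r => //; lra.
by lra.
Qed.

Lemma nbhs_of_dist x (P : set 'rV[R]_n) (e : R) :
  0 < e -> (forall z, `|z - x| < e -> P z) -> nbhs x P.
Proof.
move=> e0 h; suff : \forall z \near x, P z by [].
apply/nbhs_normP; exists e => // z; rewrite /ball_ /= distrC.
exact: h.
Qed.

Lemma open_dist (O : set 'rV[R]_n) x : open O -> O x ->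
  exists2 e : R, 0 < e & forall z, `|z - x| < e -> O z.
Proof.
move=> oO Ox; have : \forall z \near x, O z by exact: open_nbhs_nbhs.
by move=> /nbhs_normP[e e0 h]; exists e => // z zx; apply: h;
  rewrite /ball_ /= distrC.
Qed.

Lemma convex_continuous v : convex_fun v -> continuous v.
Proof.
move=> cv x; have [L L0 hL] := convex_lipschitz (`|x| + 1) cv.
have L1 : 0 < L + 1 by rewrite ltr_wpDl.
apply/(@cvgrPdist_le _ _ _ (nbhs x) (nbhs_filter x)) => e e0.
have /nbhs_of_dist : 0 < Num.min 1 (e / (L + 1)).
  by rewrite lt_min ltr01 divr_gt0.
apply=> y; rewrite lt_min distrC => /andP[xy xye].
apply: le_trans (hL _ _ _ _) _.
- by rewrite lerDl.
- rewrite -lerBlDl; apply: le_trans (ltW xy).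
  by rewrite distrC; exact: lerB_dist.
- apply: le_trans (ler_wpM2l L0 (ltW xye)) _.
  by rewrite mulrA ler_pdivrMr // mulrC ler_wpM2l ?ltW// ltr_pwDr.
Qed.

Lemma subdiff_bounded v (C : R) : convex_fun v ->
  exists K, forall b y, `|b| <= C -> subdiff v b y -> `|y| <= K.
Proof.
move=> cv; have [K K0 hK] := convex_bounded (C + 1) cv.
exists (2 * K) => b y bC hy.
apply: norm_le_coord => [|i]; first by rewrite mulr_ge0.
have step (s : R) : `|s| <= 1 -> s * y ord0 i <= 2 * K.
  move=> s1; pose e : 'rV[R]_n := delta_mx ord0 i.
  have := hy (b + s *: e); rewrite addrAC subrr add0r dotpZr.
  have -> : dotp y e = y ord0 i.
    rewrite /dotp (bigD1 i) //= big1 ?addr0 => [|j ji].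
      by rewrite mxE !eqxx mulr1.
    by rewrite mxE (negPf ji) andbF mulr0.
  have e1 : `|e| <= 1.
    apply: norm_le_coord => // j; rewrite mxE.
    by case: (_ && _); rewrite ?normr1 ?normr0.
  have := hK (b + s *: e); have := hK b; rewrite !ler_norml.
  move=> /(_ _)/wrap[]; first lra.
  move=> /andP[h1 h2] /(_ _)/wrap[].
    apply: le_trans (ler_normD _ _) _; apply: lerD => //; rewrite normrZ.
    by rewrite -[1]mulr1 ler_pM.
  by move=> /andP[h3 h4]; lra.
rewrite ler_norml lerNl; apply/andP; split.
  by rewrite -mulN1r; apply: step; rewrite normrN normr1.
by rewrite -[y _ _]mul1r; apply: step; rewrite normr1.
Qed.

Lemma local_subdiff f b y (e : R) : convex_fun f -> 0 < e ->
  (forall z, `|z - b| < e -> f b + dotp y (z - b) <= f z) -> subdiff f b y.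
Proof.
move=> cf e0 h x.
pose t := e / (e + 2 * `|x - b|).
have N0 : 0 <= `|x - b| by [].
have D0 : 0 < e + 2 * `|x - b| by lra.
have t0 : 0 < t by rewrite divr_gt0.
have t1 : t <= 1 by rewrite ler_pdivrMr //; lra.
have zE : t *: x + (1 - t) *: b - b = t *: (x - b).
  by apply/rowP => i; rewrite !mxE; ring.
have := h (t *: x + (1 - t) *: b); rewrite zE => /(_ _)/wrap[].
  rewrite normrZ gtr0_norm // /t mulrAC ltr_pdivrMr // ltr_pM2l //.
  by lra.
rewrite dotpZr => h1; have h2 := cf x b t (ltW t0) t1.
rewrite -(ler_pM2l t0); lra.
Qed.

(* A minimiser of [w' - y] over the closed ball that sits on its boundary can be
   slid towards [b] along a segment, as [w' = w] near the boundary. *)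
Lemma subdiff_eq_shell w w' (x0 : 'rV[R]_n) (r2 r3 : R) b y :
  convex_fun w -> convex_fun w' -> r2 < r3 ->
  (forall x, r2 <= `|x - x0| <= r3 -> w x = w' x) ->
  `|b - x0| < r3 -> subdiff w b y ->
  exists2 b', `|b' - x0| < r3 & subdiff w' b' y.
Proof.
move=> cw cw' r23 E br3 hy.
pose K := [set x | `|x - x0| <= r3]; pose g x := w' x - dotp y x.
have cg : convex_fun g.
  have -> : g = fun x => w' x + (dotp (- y) x + 0).
    by apply/funext => x; rewrite addr0 dotpNl.
  by apply: convex_add => //; exact: convex_affine.
have cK : compact K.
  apply: bounded_closed_compact.
    exists (r3 + `|x0|); split; first exact: num_real.
    move=> M hM x /= xK; apply/ltW/le_lt_trans/hM.
    by rewrite -lerBlDr; apply: le_trans (lerB_dist _ _) xK.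
  rewrite (_ : K = (fun x => `|x - x0|) @^-1` [set t | t <= r3]) //.
  apply: closed_comp; last exact: closed_le.
  by move=> x _; exact: (convex_continuous (convex_dist x0)).
have [||p] := @compact_EVT_min _ _ g K _ cK.
- by exists b; apply: ltW.
- by apply: continuous_subspaceT => x; exact: convex_continuous.
rewrite inE /= => pK pmin.
have {}pmin z : `|z - x0| <= r3 -> g p <= g z by move=> h; apply: pmin;
  rewrite inE.
(* A minimiser in the open ball is enough: [local_subdiff] turns minimality nearby into a global
   subgradient. *)
suff [z zr zmin] : exists2 z, `|z - x0| < r3 & g z <= g p.
  exists z => //; apply: (@local_subdiff _ _ _ (r3 - `|z - x0|)) => //.
    by rewrite subr_gt0.
  move=> x hx; have : g p <= g x.
    apply: pmin; rewrite -(subrK z x) -addrA.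
    by apply: le_trans (ler_normD _ _) _; lra.
  by rewrite /g dotpBr in zmin *; lra.
have [pr|pr] := ltP `|p - x0| r3; first by exists p.
have pE : `|p - x0| = r3 by apply/eqP; rewrite eq_le pK.
pose m := Num.max r2 `|b - x0|.
have m3 : m < r3 by rewrite gt_max r23.
have r30 : 0 < r3 by apply: le_lt_trans br3.
have B0 : 0 <= `|b - x0| by [].
(* [s] close to 1, so that the point stays in the shell *)
pose s : R := 1 - (r3 - m) / (2 * r3 + 1).
have D0 : 0 < 2 * r3 + 1 by lra.
have bm : `|b - x0| <= m by rewrite le_max lexx orbT.
have u0 : 0 < (r3 - m) / (2 * r3 + 1) by rewrite divr_gt0 ?subr_gt0.
have u1 : (r3 - m) / (2 * r3 + 1) <= 1.
  by rewrite ler_pdivrMr //; lra.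
have u2 : (r3 - m) / (2 * r3 + 1) * (2 * r3) <= r3 - m.
  by rewrite mulrAC ler_pdivrMr // ler_pM2l ?subr_gt0//; lra.
rewrite -/s in u0 u1 u2.
set u := (r3 - m) / (2 * r3 + 1) in s u0 u1 u2 *.
have zE : s *: p + (1 - s) *: b - x0 = s *: (p - x0) + (1 - s) *: (b - x0).
  by apply/rowP => i; rewrite !mxE; ring.
have s0 : 0 <= s by rewrite /s; lra.
have s1 : s <= 1 by rewrite /s; lra.
have s1' : 0 <= 1 - s by lra.
have zlt : `|s *: p + (1 - s) *: b - x0| < r3.
  rewrite zE; apply: le_lt_trans (ler_normD _ _) _.
  rewrite !normrZ !ger0_norm // pE.
  have : u * `|b - x0| < u * r3 by rewrite ltr_pM2l.
  by rewrite /s; lra.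
have zge : r2 <= `|s *: p + (1 - s) *: b - x0|.
  have : s * r3 - (1 - s) * `|b - x0| <= `|s *: p + (1 - s) *: b - x0|.
    rewrite zE -pE -[s in s * _]ger0_norm // -[X in _ - X * _]ger0_norm //.
    by rewrite -!normrZ; exact: lerB_normD.
  have : r2 <= m by rewrite le_max lexx.
  have : u * `|b - x0| <= u * r3 by rewrite ler_pM2l // ltW.
  by rewrite /s; lra.
exists (s *: p + (1 - s) *: b) => //.
(* Both [p] and the slid point lie in the shell, so [w'] can be read as [w] there; since [w - y] is
   minimal at [b], moving towards [b] does not increase it. *)
have wp : w' p = w p by rewrite E // pE (ltW r23) lexx.
have wz : w' (s *: p + (1 - s) *: b) = w (s *: p + (1 - s) *: b).
  by rewrite E // zge ltW.
have h1 := cw p b s s0 s1.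
have h3 : u * (w b + dotp y (p - b)) <= u * w p by rewrite ler_pM2l.
by rewrite /g wp wz dotpDr !dotpZr; move: h1 h3; rewrite /s dotpBr; lra.
Qed.

End ConvexFunctions.

(** * Polarization of mixed measures *)

Section Ryser.
Variables (R : comNzRingType) (n : nat).

(** Expand the product over [i] of [1 - [i not in codom f]]: a set [S] missing a value of [f] picks
    up a factor 0. The product is 1 if [f] is onto and 0 otherwise, and for a self-map of a finite
    set onto means injective. *)
Lemma sum_sign_supersets (f : {ffun 'I_n -> 'I_n}) :
  \sum_(S : {set 'I_n} | f \in ffun_on (mem S)) (-1) ^+ #|~: S| =
  (injectiveb f)%:R :> R.
Proof.
transitivity (\prod_(i < n) (1 + - (i \notin codom f)%:R) : R).
  rewrite bigA_distr [LHS]big_mkcond /=; apply: eq_bigr => S _.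
  case: ifP => [/ffun_onP fS|/negP fS].
    rewrite (bigID (mem S)) /= big1 => [|i ->//]; rewrite mul1r.
    rewrite (eq_bigr (fun=> -1)) => [|i /negPf iS].
      by rewrite prodr_const; congr (_ ^+ _); apply: eq_card => i; rewrite !inE.
    rewrite iS; case: codomP => //= -[l il]; move: (fS l).
    by rewrite -il iS.
  have /existsP[l lS] : [exists l, f l \notin S].
    apply/existsP; apply: contrapT => h; apply: fS; apply/ffun_onP => l.
    by apply: contrapT => /negP lS; apply: h; exists l.
  by rewrite (bigD1 (f l)) //= (negPf lS) codom_f oppr0 mul0r.
have [/injectiveP fi|fi] := boolP (injectiveb f).
  rewrite big1 // => i _.
  have /codomP[l ->] : i \in codom f by apply: (inj_card_onto fi);
    rewrite ?leqnn.
  by rewrite codom_f subr0.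
suff /existsP[i ic] : [exists i, i \notin codom f].
  by rewrite (bigD1 i) //= ic subrr mul0r.
apply: contraR fi; rewrite negb_exists => /forallP h.
have /image_injP fi : #|codom f| == #|'I_n|.
  by apply/eqP/eq_card => i; rewrite inE; have := h i; rewrite negbK => ->.
by apply/injectiveP => x y; apply: fi.
Qed.

(** Ryser's formula for the permanent: expanding the products yields all maps [f], and the signed
    sum over the sets containing the image of [f] retains the bijections. *)
Lemma ryser (X : 'I_n -> 'I_n -> R) :
  \sum_(S : {set 'I_n}) (-1) ^+ #|~: S| * \prod_l \sum_(i in S) X i l =
  \sum_(s : {perm 'I_n}) \prod_l X (s l) l.
Proof.
under eq_bigr => S _ do rewrite bigA_distr_big mulr_sumr big_mkcond.
rewrite exchange_big /=.
transitivity (\sum_(f : {ffun 'I_n -> 'I_n} | injectiveb f) \prod_l X (f l) l).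
  rewrite [RHS]big_mkcond; apply: eq_bigr => f _; rewrite -big_mkcond /=.
  rewrite -mulr_suml sum_sign_supersets.
  by case: ifP; rewrite (mul1r, mul0r).
rewrite (reindex (@pval _)) /=; last first.
  pose in_Sn := insubd (1%g : {perm 'I_n}).
  by exists in_Sn => /= f Uf; first apply: val_inj; exact: insubdK.
apply: eq_big => [s|s _]; first by rewrite (valP s).
by apply: eq_bigr => l _; rewrite -pvalE.
Qed.

End Ryser.

(** * Finiteness, polarization and multilinearity of mixed masses *)

Section Mixed.
Variables (R : realType) (n : nat).
Hypothesis n_gt0 : (0 < n)%N.
Variable M : ('I_n -> 'rV[R]_n -> R) -> {measure set borelRV R n -> \bar R}.
Hypothesis HM : is_mixed_MA M.

Local Notation family := ('I_n -> 'rV[R]_n -> R).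
Implicit Types (w : family) (B : set 'rV[R]_n) (g : 'rV[R]_n -> R).

Definition convex_family w := forall i, convex_fun (w i).

Definition bounded_borel B :=
  measurable (B : set (borelRV R n)) /\ exists C : R, forall x, B x ->
    `|x| <= C.

(** [fine] sends an infinite mass to 0, so this is faithful only where [M_fin] applies: convex
    entries and bounded Borel sets. *)
Definition mixed w B : R := fine (M w B).

Lemma MA_ge0 g B : (0 <= MA g B)%E.
Proof. exact: lebesgue_outer_ge0. Qed.

Lemma MA_fin g B : convex_fun g -> bounded_borel B -> MA g B \is a fin_num.
Proof.
move=> cg [_ [C hC]]; rewrite ge0_fin_numE ?MA_ge0 //.
have [K hK] := subdiff_bounded C cg.
apply: (@lebesgue_outer_fin _ _ n_gt0 _ K) => y [b Bb]; apply: hK.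
exact: hC.
Qed.

Lemma MA_sum m (vs : 'I_m -> 'rV[R]_n -> R) (lam : 'I_m -> R) B :
  (forall i, convex_fun (vs i)) -> (forall i, 0 <= lam i) ->
  measurable (B : set (borelRV R n)) ->
  MA (fun x => \sum_(i < m) lam i * vs i x) B =
  (\sum_(f : {ffun 'I_n -> 'I_m})
     (\prod_(l < n) lam (f l))%:E * M (fun l => vs (f l)) B)%E.
Proof. by move=> cv l0 mB; case: HM => _; apply. Qed.

(** With all coefficients 1, [M w B] is the term of the identity map in the expansion of the
    right-hand side, and the other terms are nonnegative. Finiteness of [M] is obtained this way. *)
Lemma M_le_MA w B : convex_family w -> measurable (B : set (borelRV R n)) ->
  (M w B <= MA (fun x => (\sum_i w i x)%R) B)%E.
Proof.
move=> cw mB.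
have -> : (fun x => \sum_i w i x) = fun x => \sum_i (fun=> 1) i * w i x.
  by apply/funext => x; apply: eq_bigr => i _; rewrite mul1r.
rewrite MA_sum // (bigD1 [ffun i => i]) //=.
rewrite big1 // mul1e (_ : (fun l => _) = w); last first.
  by apply/funext => l; rewrite ffunE.
by rewrite leeDl // sume_ge0 // => f _; rewrite mule_ge0 // lee_fin prodr_ge0.
Qed.

Lemma M_fin w B : convex_family w -> bounded_borel B -> M w B \is a fin_num.
Proof.
move=> cw bB; rewrite ge0_fin_numE //.
apply: le_lt_trans (M_le_MA cw bB.1) _.
by rewrite -ge0_fin_numE ?MA_ge0 // MA_fin //; apply: convex_sum.
Qed.

Lemma mixedE w B : convex_family w -> bounded_borel B -> M w B = (mixed w B)%:E.
Proof. by move=> cw bB; rewrite fineK // M_fin. Qed.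

Lemma mixed_ge0 w B : 0 <= mixed w B.
Proof. exact: fine_ge0. Qed.

Lemma mixed_perm w (s : {perm 'I_n}) B : convex_family w ->
  mixed (w \o s) B = mixed w B.
Proof. by move=> cw; rewrite /mixed (HM.1 w s cw). Qed.

Lemma fine_MA_sum m (vs : 'I_m -> 'rV[R]_n -> R) (lam : 'I_m -> R) B :
  (forall i, convex_fun (vs i)) -> (forall i, 0 <= lam i) -> bounded_borel B ->
  fine (MA (fun x => \sum_(i < m) lam i * vs i x) B) =
  \sum_(f : {ffun 'I_n -> 'I_m})
     (\prod_(l < n) lam (f l)) * mixed (fun l => vs (f l)) B.
Proof.
move=> cv l0 bB; rewrite MA_sum //; last by case: bB.
under eq_bigr => f _ do rewrite mixedE // -EFinM.
by rewrite sumEFin.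
Qed.

Let polar w B :=
  \sum_(S : {set 'I_n}) (-1) ^+ #|~: S| * fine (MA (fun x =>
    \sum_(i in S) w i x) B).

(** By [ryser], the coefficient of the selection [f] is a permanent of entries of [A]. Reindexing
    [f] by a permutation and using the symmetry of [mixed], all [n!] permutations contribute
    equally. *)
Let polarE m (vs : 'I_m -> 'rV[R]_n -> R) (A : 'I_n -> 'I_m -> R) B :
  (forall i, convex_fun (vs i)) -> (forall i a, 0 <= A i a) ->
    bounded_borel B ->
  polar (fun i x => \sum_a A i a * vs a x) B =
  n`!%:R * \sum_(f : {ffun 'I_n -> 'I_m})
    (\prod_i A i (f i)) * mixed (fun l => vs (f l)) B.
Proof.
move=> cv A0 bB.
transitivity (\sum_(f : {ffun 'I_n -> 'I_m}) \sum_(s : {perm 'I_n})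
    (\prod_l A (s l) (f l)) * mixed (fun l => vs (f l)) B).
  rewrite /polar.
  transitivity (\sum_(S : {set 'I_n}) \sum_(f : {ffun 'I_n -> 'I_m})
      (-1) ^+ #|~: S| * (\prod_l \sum_(i in S) A i (f l)) *
      mixed (fun l => vs (f l)) B).
    apply: eq_bigr => S _.
    have -> : (fun x => \sum_(i in S) \sum_a A i a * vs a x) =
              fun x => \sum_a (\sum_(i in S) A i a) * vs a x.
      apply/funext => x; rewrite exchange_big /=; apply: eq_bigr => a _.
      by rewrite mulr_suml.
    rewrite fine_MA_sum // => [|a]; last by apply: sumr_ge0.
    by rewrite mulr_sumr; apply: eq_bigr => f _; rewrite mulrA.
  rewrite exchange_big /=; apply: eq_bigr => f _.
  by rewrite -mulr_suml (ryser (fun i l => A i (f l))) mulr_suml.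
rewrite exchange_big /= (eq_bigr (fun=> \sum_(f : {ffun 'I_n -> 'I_m})
    (\prod_i A i (f i)) * mixed (fun l => vs (f l)) B)) => [|s _].
  rewrite sumr_const -[LHS]mulr_natl; congr (_%:R * _).
  rewrite (_ : #|_| = #|perm_on [set: 'I_n]%SET|).
    by rewrite card_perm cardsT card_ord.
  apply: eq_card => s; transitivity true => //.
  by apply/esym/fintype.subsetP => i _; rewrite inE.
rewrite (reindex (fun g : {ffun 'I_n -> 'I_m} => [ffun l => g (s l)])) /=.
  apply: eq_bigr => g _; rewrite [in RHS](reindex_inj (@perm_inj _ s)) /=.
  under eq_bigr => l _ do rewrite ffunE.
  rewrite -(mixed_perm s _ (fun i => cv (g i))); congr (_ * mixed _ _).
  by apply/funext => l; rewrite /= ffunE.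
exists (fun g : {ffun 'I_n -> 'I_m} => [ffun l => g ((s^-1)%g l)]) => g _.
  by apply/ffunP => l; rewrite !ffunE permKV.
by apply/ffunP => l; rewrite !ffunE permK.
Qed.

Let fact_neq0 : n`!%:R != 0 :> R.
Proof. by rewrite pnatr_eq0 -lt0n fact_gt0. Qed.

Lemma polar_mixed w B : convex_family w -> bounded_borel B ->
  polar w B = n`!%:R * mixed w B.
Proof.
move=> cw bB.
pose A (i a : 'I_n) : R := (i == a)%:R.
have wE : (fun i x => \sum_a A i a * w a x) = w.
  apply/funext => i; apply/funext => x; rewrite (bigD1 i) //= big1.
    by rewrite /A eqxx mul1r addr0.
  by move=> a /negPf ai; rewrite /A eq_sym ai mul0r.
rewrite -{1}wE polarE //; congr (_ * _).
rewrite (bigD1 [ffun i => i]) //= [X in _ + X]big1 ?addr0; last first.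
  move=> f fi; have /existsP[i hi] : [exists i, f i != i].
    apply: contraR fi; rewrite negb_exists => /forallP h.
    by apply/eqP/ffunP => i; rewrite ffunE; apply/eqP; have := h i;
      rewrite negbK.
  by rewrite (bigD1 i) //= /A eq_sym (negPf hi) !mul0r.
rewrite big1 ?mul1r => [|i _]; last by rewrite /A ffunE eqxx.
by congr (mixed _ _); apply/funext => i; rewrite ffunE.
Qed.

(** The defining expansion only treats one function repeated [n] times. Distinct entries are reached
    by computing [polar] twice: from the [vs], and with the combinations themselves as entries. *)
Lemma mixed_multilinear m (vs : 'I_m -> 'rV[R]_n -> R) (A : 'I_n -> 'I_m ->
  R) B :
  (forall i, convex_fun (vs i)) -> (forall i a, 0 <= A i a) ->
    bounded_borel B ->
  mixed (fun i x => \sum_a A i a * vs a x) B =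
  \sum_(f : {ffun 'I_n -> 'I_m})
    (\prod_i A i (f i)) * mixed (fun l => vs (f l)) B.
Proof.
move=> cv A0 bB; apply: (mulfI fact_neq0); rewrite -polarE //.
rewrite polar_mixed // => i; apply: convex_sum => a _.
exact: convex_scale.
Qed.

(* By polarization, mixed measures of [B] only depend on the Monge-Ampere
   measures of the partial sums. *)
Lemma eq_mixed w w' B : convex_family w -> convex_family w' ->
  bounded_borel B ->
  (forall S : {set 'I_n}, MA (fun x => \sum_(i in S) w i x) B =
                         MA (fun x => \sum_(i in S) w' i x) B) ->
  mixed w B = mixed w' B.
Proof.
move=> cw cw' bB h; apply: (mulfI fact_neq0); rewrite -!polar_mixed //.
by apply: eq_bigr => S _; rewrite h.
Qed.

Definition upd w (i : 'I_n) g : family := fun l => if l == i then g else w l.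

Lemma convex_upd w i g : convex_family w -> convex_fun g ->
  convex_family (upd w i g).
Proof. by move=> cw cg l; rewrite /upd; case: ifP. Qed.

Lemma upd_id w i : upd w i (w i) = w.
Proof. by apply/funext => l; rewrite /upd; case: eqP => [->|]. Qed.

Lemma mixed_upd_lin w i g g' (a c : R) B : convex_family w -> convex_fun g ->
  convex_fun g' -> 0 <= a -> 0 <= c -> bounded_borel B ->
  mixed (upd w i (fun x => a * g x + c * g' x)) B =
  a * mixed (upd w i g) B + c * mixed (upd w i g') B.
Proof.
move=> cw cg cg' a0 c0 bB.
(* Index [ord0] carries [g'], the lifted indices carry [upd w i g]. Only row [i] of [A] can have two
   nonzero entries, so the selections [f0] and [f1] alone survive. *)
pose vs (b : 'I_n.+1) := oapp (upd w i g) g' (unlift ord0 b).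
pose A (l : 'I_n) (b : 'I_n.+1) : R :=
  if l == i then oapp (fun k => if k == i then a else 0) c (unlift ord0 b)
  else oapp (fun k => (k == l)%:R) 0 (unlift ord0 b).
have -> : upd w i (fun x => a * g x + c * g' x) =
    fun l x => \sum_b A l b * vs b x.
  apply/funext => l; apply/funext => x; rewrite /upd big_ord_recl /A /vs.
  rewrite unlift_none /= (bigD1 l) //= liftK /= eqxx big1 => [|k /negPf kl].
    have [->|/negPf li] := eqVneq l i; first by rewrite /upd eqxx addr0 addrC.
    by rewrite /upd li mul0r add0r mul1r addr0.
  rewrite liftK /= kl; have [li|_] := eqVneq l i; last by rewrite mul0r.
  by rewrite -li kl mul0r.
rewrite mixed_multilinear //; last first.
- by move=> l b; rewrite /A; case: ifP => _; case: unlift => //= k; case: ifP.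
- by move=> b; rewrite /vs; case: unlift => //= k; exact: convex_upd.
pose f0 := [ffun l : 'I_n => lift ord0 l].
pose f1 := [ffun l : 'I_n => if l == i then ord0 else lift ord0 l].
have f10 : f1 != f0.
  by apply/eqP => /ffunP /(_ i); rewrite !ffunE eqxx => /(congr1 val).
rewrite (bigD1 f0) //= (bigD1 f1) //= [X in _ + (_ + X)]big1 ?addr0; last first.
  move=> f /andP[ff0 ff1].
  suff /existsP[l /eqP hl] : [exists l, A l (f l) == 0].
    by rewrite (bigD1 l) //= hl !mul0r.
  apply: contraT; rewrite negb_exists => /forallP h.
  have fl l : l != i -> f l = lift ord0 l.
    move=> /negPf li; have := h l; rewrite /A li.
    case: unliftP => [k ->|_] /=; last by rewrite eqxx.
    by case: (k =P l) => [->|]; rewrite // eqxx.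
  have [k fi|fi] := unliftP ord0 (f i).
    case/eqP: ff0; apply/ffunP => l; rewrite ffunE.
    have [->|/fl//] := eqVneq l i; have := h i.
    rewrite /A eqxx fi liftK /=; case: (k =P i) => [->//|].
    by rewrite eqxx.
  case/eqP: ff1; apply/ffunP => l; rewrite ffunE.
  by case: ifPn => [/eqP ->|/fl].
have prodE (f : {ffun 'I_n -> 'I_n.+1}) e : A i (f i) = e ->
    (forall l, l != i -> A l (f l) = 1) -> \prod_l A l (f l) = e.
  by move=> fi fl; rewrite (bigD1 i) //= fi big1 ?mulr1.
congr (_ * mixed _ _ + _ * mixed _ _).
- apply: prodE => [|l /negPf li]; rewrite /A ffunE ?li ?eqxx liftK //= eqxx//.
- by apply/funext => l; rewrite ffunE /vs liftK.
- apply: prodE => [|l /negPf li]; rewrite /A ffunE ?li ?eqxx ?unlift_none//.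
  by rewrite liftK /= eqxx.
- apply/funext => l; rewrite ffunE /vs /upd.
  have [_|/negPf li] := eqVneq l i; first by rewrite unlift_none.
  by rewrite liftK /= /upd li.
Qed.

End Mixed.

(** * Locality and semicontinuity *)

Section MixedLocal.
Variables (R : realType) (n : nat).
Hypothesis n_gt0 : (0 < n)%N.
Variable M : ('I_n -> 'rV[R]_n -> R) -> {measure set borelRV R n -> \bar R}.
Hypothesis HM : is_mixed_MA M.

Local Notation family := ('I_n -> 'rV[R]_n -> R).
Local Notation mixed := (mixed M).
Implicit Types (w : family) (A B O : set 'rV[R]_n) (f g : 'rV[R]_n -> R).

Definition oball (x0 : 'rV[R]_n) (r : R) := [set x | `|x - x0| < r].

Lemma open_borel O (C : R) : open O -> (forall x, O x -> `|x| <= C) ->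
  bounded_borel O.
Proof. by move=> oO hC; split; [exact: sub_sigma_algebra|exists C]. Qed.

Lemma open_oball (x0 : 'rV[R]_n) (r : R) : open (oball x0 r).
Proof.
rewrite (_ : oball x0 r = (fun x => `|x - x0|) @^-1` [set t | t < r]) //.
apply: open_comp => [x _|]; last exact: open_lt.
exact: (convex_continuous (convex_dist x0)).
Qed.

Lemma le_norm_center (x x0 : 'rV[R]_n) (r : R) :
  `|x - x0| <= r -> `|x| <= r + `|x0|.
Proof.
by move=> xr; rewrite -lerBlDr; apply: le_trans xr; exact: lerB_dist.
Qed.

Lemma oball_borel (x0 : 'rV[R]_n) (r : R) : bounded_borel (oball x0 r).
Proof.
apply: (@open_borel _ (r + `|x0|)) => [|x xr]; first exact: open_oball.
exact/le_norm_center/ltW.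
Qed.

Lemma le_mixed w A B : convex_family w -> bounded_borel A -> bounded_borel B ->
  A `<=` B -> mixed w A <= mixed w B.
Proof.
move=> cw bA bB AB; rewrite -lee_fin -!(mixedE n_gt0 HM) //.
by apply: le_measure => //; rewrite inE; [case: bA|case: bB].
Qed.

Lemma mixed_sub0 w A B : convex_family w -> bounded_borel A ->
  bounded_borel B ->
  A `<=` B -> mixed w B = 0 -> mixed w A = 0.
Proof.
move=> cw bA bB AB B0; apply/eqP; rewrite eq_le (mixed_ge0 M) andbT -B0.
exact: le_mixed.
Qed.

Lemma bounded_borelU A B : bounded_borel A -> bounded_borel B ->
  bounded_borel (A `|` B).
Proof.
move=> [mA [C hC]] [mB [C' hC']]; split; first exact: measurableU.
exists (Num.max C C') => x; rewrite le_max => -[/hC ->//|/hC' ->].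
by rewrite orbT.
Qed.

Lemma mixedU0 w A B : convex_family w -> bounded_borel A -> bounded_borel B ->
  mixed w A = 0 -> mixed w B = 0 -> mixed w (A `|` B) = 0.
Proof.
move=> cw bA bB A0 B0; apply/eqP; rewrite eq_le (mixed_ge0 M) andbT.
rewrite -lee_fin -(mixedE n_gt0 HM) //; last exact: bounded_borelU.
apply: (@le_trans _ _ (M w A + M w B)%E).
  by apply: measureU2; [case: bA|case: bB].
by rewrite !(mixedE n_gt0 HM) // A0 B0 adde0.
Qed.

Lemma subdiff_local_affine f f' O (p : 'rV[R]_n) (c : R) b y :
  convex_fun f' -> open O -> (forall x, O x -> f x = f' x + (dotp p x + c)) ->
  O b -> subdiff f b y -> subdiff f' b (y - p).
Proof.
move=> cf oO E Ob hy; have [e e0 he] := open_dist oO Ob.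
apply: (local_subdiff cf e0) => z zb; have := hy z.
rewrite !E //; last exact: he.
by rewrite dotpBl !dotpBr; lra.
Qed.

(** An affine summand translates the gradient image by its slope [p], and the outer measure is
    translation invariant. *)
Lemma MA_local f f' O (p : 'rV[R]_n) (c : R) :
  convex_fun f -> convex_fun f' -> open O ->
  (forall x, O x -> f x = f' x + (dotp p x + c)) -> MA f O = MA f' O.
Proof.
move=> cf cf' oO E.
rewrite /MA -[RHS](lebesgue_outer_translate p); congr lebesgue_outer.
apply/seteqP; split=> [y [b Ob hy]|_ [y [b Ob hy] <-]].
  exists (y - p); last by rewrite subrK.
  by exists b => //; apply: (subdiff_local_affine cf' oO E).
exists b => //; rewrite -[p]opprK.
apply: (@subdiff_local_affine f' f O (- p) (- c)) => // x Ox.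
by rewrite E // dotpNl; ring.
Qed.

Lemma mixed_local w w' O (C : R) : convex_family w -> convex_family w' ->
  open O -> (forall x, O x -> `|x| <= C) ->
  (forall i, exists p c, forall x, O x -> w i x = w' i x + (dotp p x + c)) ->
  mixed w O = mixed w' O.
Proof.
move=> cw cw' oO hC /choice[p /choice[c E]].
apply: (eq_mixed n_gt0 HM) => // [|S]; first exact: open_borel hC.
apply: (@MA_local _ _ _ (\sum_(i in S) p i) (\sum_(i in S) c i)) => //.
- exact: convex_sum.
- exact: convex_sum.
move=> x Ox; rewrite (eq_bigr _ (fun i _ => E i x Ox)) !big_split /=.
congr (_ + (_ + _)); rewrite /dotp exchange_big /=; apply: eq_bigr => l _.
by rewrite summxE mulr_suml.
Qed.

Lemma mixed_upd_eq_on w i g g' O (C : R) : convex_family w -> convex_fun g ->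
  convex_fun g' -> open O -> (forall x, O x -> `|x| <= C) ->
  (forall x, O x -> g x = g' x) ->
  mixed (upd w i g) O = mixed (upd w i g') O.
Proof.
move=> cw cg cg' oO hC E; apply: (mixed_local _ _ oO hC).
- exact: convex_upd.
- exact: convex_upd.
move=> l; exists 0, 0 => x Ox; rewrite dotp0l !addr0 /upd.
by case: ifP => // _; exact: E.
Qed.

Lemma mixed_upd0 w i B : convex_family w -> bounded_borel B ->
  mixed (upd w i (fun=> 0)) B = 0.
Proof.
move=> cw bB; have c0 : convex_fun (fun _ : 'rV[R]_n =>
  0 : R) by exact: convex_cst.
have := mixed_upd_lin n_gt0 HM i cw c0 c0 (lexx 0) (lexx 0) bB.
rewrite !mul0r addr0 => E; rewrite -[RHS]E; congr (mixed (upd _ _ _) _).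
Qed.

Lemma mixed_affine0 w i O (C : R) (p : 'rV[R]_n) (c : R) : convex_family w ->
  open O -> (forall x, O x -> `|x| <= C) ->
  (forall x, O x -> w i x = dotp p x + c) -> mixed w O = 0.
Proof.
move=> cw oO hC E; rewrite -(mixed_upd0 i cw (open_borel oO hC)).
apply: (mixed_local cw _ oO hC).
  by apply: convex_upd => //; exact: convex_cst.
move=> l; have [->|/negPf li] := eqVneq l i.
  by exists p, c => x Ox; rewrite /upd eqxx add0r E.
by exists 0, 0 => x Ox; rewrite /upd li dotp0l !addr0.
Qed.

Lemma mixed_shell w w' (x0 : 'rV[R]_n) (r2 r3 : R) :
  convex_family w -> convex_family w' -> r2 < r3 ->
  (forall i x, r2 <= `|x - x0| <= r3 -> w i x = w' i x) ->
  mixed w (oball x0 r3) = mixed w' (oball x0 r3).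
Proof.
move=> cw cw' r23 E.
apply: (eq_mixed n_gt0 HM) => // [|S]; first exact: oball_borel.
rewrite /MA; congr lebesgue_outer.
have H u u' : convex_family u -> convex_family u' ->
    (forall i x, r2 <= `|x - x0| <= r3 -> u i x = u' i x) ->
    \bigcup_(b in oball x0 r3) subdiff (fun x => \sum_(i in S) u i x) b `<=`
    \bigcup_(b in oball x0 r3) subdiff (fun x => \sum_(i in S) u' i x) b.
  move=> cu cu' uE y [b br hy].
  have [|||b' b'r hy'] := @subdiff_eq_shell _ _ _
      (fun x => \sum_(i in S) u' i x) x0 r2 r3 b y _ _ r23 _ br hy.
  - exact: convex_sum.
  - exact: convex_sum.
  - by move=> x hx; apply: eq_bigr => i _; apply: uE.
  by exists b'.
by apply/seteqP; split; apply: H => // i x hx; rewrite E.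
Qed.

Lemma mixed_upd_sum0 w i B (I : Type) (s : seq I) (G : I -> 'rV[R]_n -> R) :
  convex_family w -> bounded_borel B -> (forall a, convex_fun (G a)) ->
  (forall a, mixed (upd w i (G a)) B = 0) ->
  mixed (upd w i (fun x => \sum_(a <- s) G a x)) B = 0.
Proof.
move=> cw bB cG G0; elim: s => [|a s IH].
  rewrite (_ : (fun x => _) = fun=> 0) ?mixed_upd0 //.
  by apply/funext => x; rewrite big_nil.
rewrite (_ : (fun x => _) = fun x => 1 * G a x + 1 * \sum_(a <- s) G a x).
  rewrite (mixed_upd_lin n_gt0 HM) // ?ler01 //; last exact: convex_sum.
  by rewrite G0 IH !mulr0 addr0.
by apply/funext => x; rewrite big_cons !mul1r.
Qed.

Lemma mixed_upd_summand0 w i B g g' (a c : R) : convex_family w ->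
  bounded_borel B -> convex_fun g -> convex_fun g' -> 0 < a -> 0 <= c ->
  mixed (upd w i (fun x => a * g x + c * g' x)) B = 0 ->
  mixed (upd w i g) B = 0.
Proof.
move=> cw bB cg cg' a0 c0; rewrite (mixed_upd_lin n_gt0 HM) ?(ltW a0) // =>
  /eqP.
rewrite paddr_eq0 ?mulr_ge0 ?(mixed_ge0 M) ?(ltW a0) // => /andP[+ _].
by rewrite mulf_eq0 (gt_eqF a0) => /eqP.
Qed.

(* A small multiple [d] of the distance to [x0] lets one glue [g] inside the
   smaller ball to its approximation [g'] near the boundary of the larger one;
   by [mixed_shell] the gluing does not change the mass of the larger ball. *)
Lemma mixed_approx0 w i g (x0 : 'rV[R]_n) (r r' : R) : convex_family w ->
  convex_fun g -> r < r' ->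
  (forall e, 0 < e -> exists g', [/\ convex_fun g',
     forall x, `|x - x0| <= r' -> `|g' x - g x| <= e &
     mixed (upd w i g') (oball x0 r') = 0]) ->
  mixed (upd w i g) (oball x0 r) = 0.
Proof.
move=> cw cg rr' h.
(* [r + c] is halfway between [r] and [r2], so [q] is at most [- c] on the small ball and at least
   [c] beyond [r2]. *)
pose r2 := (r + r') / 2; pose c := (r2 - r) / 2.
have r2r : r < r2 by rewrite /r2; lra.
have r2r' : r2 < r' by rewrite /r2; lra.
have c0 : 0 < c by rewrite /c; lra.
pose q (x : 'rV[R]_n) := `|x - x0| + (dotp 0 x - (r + c)).
have qE x : q x = `|x - x0| - (r + c) by rewrite /q dotp0l add0r.
have cq : convex_fun q.
  by apply: convex_add; [exact: convex_dist|exact: convex_affine].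
set K := mixed (upd w i q) (oball x0 r').
have K0 : 0 <= K by exact: (mixed_ge0 M).
set m := mixed _ _; apply/eqP; rewrite eq_le (mixed_ge0 M) andbT.
rewrite leNgt; apply/negP => m0.
(* This makes [d * K = m * K / (K + 1) < m], against the inequality [m <= d * K] that the gluing
   gives; and [d * c = e] lets [d * q] absorb the error of [g']. *)
pose e := m * c / (K + 1).
have K1 : 0 < K + 1 by lra.
have e0 : 0 < e by apply: divr_gt0 => //; exact: mulr_gt0.
have [g' [cg' gg' Tg']] := h e e0.
pose d := e / c; have d0 : 0 < d by rewrite divr_gt0.
pose k x := 1 * g' x + d * q x.
have ck : convex_fun k by rewrite /k; apply: convex_add; apply: convex_scale;
  rewrite ?ler01 ?(ltW d0).
pose u x := Num.max (k x) (g x).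
have cu : convex_fun u by exact: convex_max.
have dc : d * c = e by rewrite /d mulfVK // gt_eqF.
have : m <= d * K.
  have -> : d * K = mixed (upd w i u) (oball x0 r').
    rewrite (@mixed_shell _ (upd w i k) x0 r2 r') //.
    - by rewrite (mixed_upd_lin n_gt0 HM) ?Tg' ?mulr0 ?add0r ?ltW //;
      exact: oball_borel.
    - exact: convex_upd.
    - exact: convex_upd.
    move=> l x /andP[x2 x3]; rewrite /upd; case: ifP => // _; apply/max_idPl.
    have := gg' x x3; rewrite ler_norml => /andP[h1 h2].
    have : d * c <= d * q x by rewrite ler_pM2l // qE; move: x2; rewrite /c;
      lra.
    by rewrite /k; lra.
  have -> : m = mixed (upd w i u) (oball x0 r).
    apply: (@mixed_upd_eq_on _ _ _ _ _ (r + `|x0|)) => //.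
    - exact: open_oball.
    - by move=> x xr; exact/le_norm_center/ltW.
    move=> x; rewrite /oball /= => xr; apply/esym/max_idPr.
    have := gg' x (ltW (lt_trans xr rr')); rewrite ler_norml => /andP[h1 h2].
    have : d * q x <= d * (- c) by rewrite ler_pM2l // qE; lra.
    by rewrite /k; lra.
  apply: le_mixed; [exact: convex_upd|exact: oball_borel|exact: oball_borel|].
  by move=> x; rewrite /oball /= => xr; exact: lt_trans rr'.
rewrite (_ : d * K = m * K / (K + 1)); last first.
  by rewrite /d /e; field; rewrite !gt_eqF.
by apply/negP; rewrite -ltNge ltr_pdivrMr // ltr_pM2l //; lra.
Qed.

(** Truncate the entry [i] from below at [e]: near the hyperplane it is constant, while on either
    side of the hyperplane the untouched entry [i'] is affine. Three open sets of mass zero cover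
    the ball. *)
Lemma mixed_repeat0 w i i' (x0 : 'rV[R]_n) (r : R) (p : 'rV[R]_n) (c : R) :
  convex_family w -> i != i' ->
  w i = (fun x => `|dotp p x + c|) -> w i' = (fun x => `|dotp p x + c|) ->
  mixed w (oball x0 r) = 0.
Proof.
move=> cw ii' wi wi'; rewrite -(upd_id w i) wi.
have cl : convex_fun (fun x => dotp p x + c) by exact: convex_affine.
have cabs : convex_fun (fun x => `|dotp p x + c|) by exact: convex_abs_affine.
have oL : continuous (fun x : 'rV[R]_n =>
  dotp p x + c) by exact: convex_continuous.
apply: (@mixed_approx0 _ _ _ x0 r (r + 1)) => // [|e e0];
  first by rewrite ltrDl.
exists (fun x => Num.max e `|dotp p x + c|); split.
- by apply: convex_max => //; exact: convex_cst.
- move=> x _; set t := `|dotp p x + c|; have t0 : 0 <= t by exact: normr_ge0.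
  by rewrite ler_norml; have [et|et] := leP e t; apply/andP; split; lra.
set w' := upd w i _; set D := oball x0 (r + 1).
have cw' : convex_family w'.
  by apply: convex_upd => //; apply: convex_max => //; exact: convex_cst.
have Db x : D x -> `|x| <= r + 1 + `|x0| by move=> xr; exact/le_norm_center/ltW.
have oD : open D by exact: open_oball.
pose O1 := D `&` [set x | `|dotp p x + c| < e].
pose O2 := D `&` [set x | 0 < dotp p x + c].
pose O3 := D `&` [set x | dotp p x + c < 0].
have oO1 : open O1.
  apply: openI => //; apply: (@open_comp _ _ _ [set t | t < e]) => [x _|].
    exact: (convex_continuous cabs).
  exact: open_lt.
have oO2 : open O2.
  apply: openI => //; apply: (@open_comp _ _ (fun x =>
    dotp p x + c) [set t | 0 < t]) => [x _|].
    exact: oL.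
  exact: open_gt.
have oO3 : open O3.
  apply: openI => //; apply: (@open_comp _ _ (fun x =>
    dotp p x + c) [set t | t < 0]) => [x _|].
    exact: oL.
  exact: open_lt.
have O1b x : O1 x -> `|x| <= r + 1 + `|x0| by move=> [/Db].
have O2b x : O2 x -> `|x| <= r + 1 + `|x0| by move=> [/Db].
have O3b x : O3 x -> `|x| <= r + 1 + `|x0| by move=> [/Db].
have w'i' : w' i' = fun x => `|dotp p x + c|.
  by rewrite /w' /upd eq_sym (negPf ii').
apply: (@mixed_sub0 _ _ (O1 `|` (O2 `|` O3))) => //.
- exact: oball_borel.
- by apply: bounded_borelU; [|apply: bounded_borelU]; apply: open_borel;
  eassumption.
- move=> x Dx; have [l0|l0|l0] := ltgtP 0 (dotp p x + c).
  + by right; left.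
  + by right; right.
  + by left; split => //=; rewrite -l0 normr0.
apply: mixedU0 => //; [exact: open_borel O1b| |
    |apply: mixedU0 => //; [exact: open_borel O2b|exact: open_borel O3b| |]].
- by apply: bounded_borelU; apply: open_borel; eassumption.
- apply: (@mixed_affine0 _ i _ _ 0 e cw' oO1 O1b) => x [_ /= xe].
  by rewrite /w' /upd eqxx dotp0l add0r; apply/max_idPl/ltW.
- apply: (@mixed_affine0 _ i' _ _ p c cw' oO2 O2b) => x [_ /= xe].
  by rewrite w'i' gtr0_norm.
- apply: (@mixed_affine0 _ i' _ _ (- p) (- c) cw' oO3 O3b) => x [_ /= xe].
  by rewrite w'i' ltr0_norm // dotpNl opprD.
Qed.

End MixedLocal.

(** * Ellipsoidal norms and polyhedral norms *)

Section EllipsoidNorms.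
Variables (R : realType) (n : nat) (p : 'rV[R]_n) (eta : R).
Hypothesis eta_gt0 : 0 < eta.
Implicit Types (x z : 'rV[R]_n).

(** The inner product of [ell_norm], the support function of an ellipsoid that shrinks to the
    segment from [- p] to [p] as [eta] tends to 0; [p = 0], [eta = 1] is the Euclidean case. *)
Definition ell_form x z := dotp p x * dotp p z + eta ^+ 2 * dotp x z.
Definition ell_norm x := Num.sqrt (ell_form x x).

Let eta2 : 0 < eta ^+ 2. Proof. exact: exprn_gt0. Qed.

Lemma ell_form_ge0 x : 0 <= ell_form x x.
Proof.
apply: addr_ge0; first by rewrite -expr2 sqr_ge0.
by apply: mulr_ge0 (dotp_ge0 x); exact: ltW.
Qed.

Lemma ell_norm_sq x : ell_norm x ^+ 2 = ell_form x x.
Proof. exact/sqr_sqrtr/ell_form_ge0. Qed.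

Lemma ell_norm_ge0 x : 0 <= ell_norm x.
Proof. exact: sqrtr_ge0. Qed.

Lemma ell_norm_gt0 x : x != 0 -> 0 < ell_norm x.
Proof.
move=> x0; rewrite sqrtr_gt0; have := dotp_ge0 x; rewrite le_eqVlt.
case/orP => [/eqP/esym/dotp_eq0 xE|xx]; first by rewrite xE eqxx in x0.
by rewrite ltr_wpDl // ?mulr_gt0 // -expr2 sqr_ge0.
Qed.

Lemma ell_norm0 : ell_norm 0 = 0.
Proof. by rewrite /ell_norm /ell_form !dotp0r !mulr0 addr0 sqrtr0. Qed.

Lemma ell_formB x z (s t : R) :
  ell_form (s *: x - t *: z) (s *: x - t *: z) =
  s ^+ 2 * ell_form x x + t ^+ 2 * ell_form z z - 2 * (s * t) * ell_form x z.
Proof.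
by rewrite /ell_form !(dotpBr, dotpBl, dotpZr, dotpZl) (dotpC z x); ring.
Qed.

(** The gradient of [ell_norm] away from 0. At 0 the convention [0^-1 = 0] yields the vector 0,
    again a subgradient. *)
Definition ell_grad x := (ell_norm x)^-1 *: (dotp p x *: p + eta ^+ 2 *: x).

Lemma dotp_ell_grad x z : dotp (ell_grad x) z = ell_form x z / ell_norm x.
Proof.
by rewrite dotpZl dotpDl !dotpZl mulrC.
Qed.

Lemma dotp_ell_grad_id x : dotp (ell_grad x) x = ell_norm x.
Proof.
have [->|x0] := eqVneq x 0; first by rewrite dotp0r ell_norm0.
by rewrite dotp_ell_grad -ell_norm_sq expr2 mulfK // gt_eqF // ell_norm_gt0.
Qed.

(* [s] and [t] are arbitrary positive weights; equality holds for
   [s = ell_norm z] and [t = ell_norm x]. *)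
Lemma ell_gap_le x z (s t : R) : x != 0 -> 0 < s -> 0 < t ->
  ell_norm z - dotp (ell_grad x) z <=
  ell_form (s *: x - t *: z) (s *: x - t *: z) / (2 * (s * t) * ell_norm x).
Proof.
move=> x0 s0 t0; have a0 := ell_norm_gt0 x0.
have st := mulr_gt0 s0 t0.
rewrite dotp_ell_grad ell_formB ler_pdivlMr; last by rewrite !mulr_gt0.
rewrite -!ell_norm_sq; set a := ell_norm x in a0 *; set b := ell_norm z.
have -> : (b - ell_form x z / a) * (2 * (s * t) * a) =
          2 * (s * a) * (t * b) - 2 * (s * t) * ell_form x z.
  by field; rewrite gt_eqF.
have := sqr_ge0 (s * a - t * b); nra.
Qed.

Lemma ell_gap_eq x z : x != 0 -> z != 0 ->
  ell_norm z - dotp (ell_grad x) z =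
  ell_form (ell_norm z *: x - ell_norm x *: z) (ell_norm z *: x - ell_norm x *:
    z)
    / (2 * (ell_norm z * ell_norm x) * ell_norm x).
Proof.
move=> x0 z0; rewrite dotp_ell_grad ell_formB -!ell_norm_sq.
by field; rewrite !gt_eqF ?ell_norm_gt0.
Qed.

Lemma ell_grad_le x z : dotp (ell_grad x) z <= ell_norm z.
Proof.
have [->|x0] := eqVneq x 0.
  by rewrite /ell_grad ell_norm0 invr0 scale0r dotp0l ell_norm_ge0.
have [->|z0] := eqVneq z 0; first by rewrite dotp0r ell_norm_ge0.
rewrite -subr_ge0 ell_gap_eq // divr_ge0 ?ell_form_ge0 //.
by rewrite !mulr_ge0 ?ell_norm_ge0.
Qed.

Lemma convex_ell_norm : convex_fun ell_norm.
Proof.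
apply: convex_of_subgradient => x; exists (ell_grad x) => z.
by rewrite dotpBr dotp_ell_grad_id addrC subrK ell_grad_le.
Qed.

End EllipsoidNorms.

(** * Ellipsoidal summands and polyhedral approximation of the Euclidean norm *)

Section Ball.
Variables (R : realType) (n : nat).
Implicit Types (x z p : 'rV[R]_n).

Lemma h_ball_ell : @h_ball R n = ell_norm 0 1.
Proof.
apply/funext => x; rewrite /h_ball /ell_norm /ell_form dotp0l mul0r add0r.
by rewrite expr1n mul1r.
Qed.

Lemma convex_h_ball : convex_fun (@h_ball R n).
Proof. by rewrite h_ball_ell; exact: (convex_ell_norm 0 ltr01). Qed.

Lemma dotp_le_h_ball p x : dotp p x <= h_ball p * h_ball x.
Proof.
have [->|p0] := eqVneq p 0.
  by rewrite dotp0l mulr_ge0 // sqrtr_ge0.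
rewrite h_ball_ell -ler_pdivrMl ?ell_norm_gt0 ?ltr01 //.
have := @ell_grad_le R n 0 1 ltr01 p x.
by rewrite dotp_ell_grad /ell_form dotp0l mul0r add0r expr1n mul1r mulrC.
Qed.

Lemma ell_form_le p (eta : R) x :
  ell_form p eta x x <= (dotp p p + eta ^+ 2) * dotp x x.
Proof.
rewrite /ell_form mulrDl lerD2r.
have h := dotp_le_h_ball p x; have := dotp_le_h_ball (- p) x.
rewrite {1}/h_ball dotpNr !dotpNl opprK -/(h_ball p) => h'.
rewrite -[dotp p p]sqr_sqrtr ?dotp_ge0 // -[dotp x x]sqr_sqrtr ?dotp_ge0 //.
rewrite -/(h_ball p) -/(h_ball x) -exprMn -expr2.
move: h h'; set t := dotp p x; set u := h_ball p * h_ball x => h h'.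
by rewrite -subr_ge0 subr_sqr mulr_ge0 // ?subr_ge0 //; lra.
Qed.

(* An ellipsoid is a summand of a large ball. *)
Lemma convex_ball_sub_ell p (eta : R) : 0 < eta ->
  convex_fun (fun x =>
    h_ball x - eta / (dotp p p + eta ^+ 2) * ell_norm p eta x).
Proof.
move=> e0; set K := dotp p p + eta ^+ 2; set c := eta / K.
have e2 : 0 < eta ^+ 2 by exact: exprn_gt0.
have K0 : 0 < K by rewrite ltr_wpDl ?dotp_ge0.
have c0 : 0 < c by rewrite divr_gt0.
have o1 : 0 < 1 :> R by exact: ltr01.
have form1 x : ell_form 0 1 x x = dotp x x.
  by rewrite /ell_form dotp0l mul0r add0r expr1n mul1r.
apply: convex_of_subgradient => x.
have [->|x0] := eqVneq x 0.
  exists 0 => z; rewrite dotp0l addr0 /h_ball dotp0l sqrtr0 ell_norm0 mulr0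
    subr0.
  rewrite subr_ge0 -/(h_ball z) h_ball_ell -ler_sqr ?nnegrE ?pmulr_rge0
    ?ell_norm_ge0 //.
  rewrite exprMn !ell_norm_sq // form1.
  apply: (@le_trans _ _ (c ^+ 2 * (K * dotp z z))).
    by rewrite ler_pM2l ?exprn_gt0 // ell_form_le.
  rewrite mulrA ler_piMl ?dotp_ge0 //.
  rewrite /c expr_div_n expr2 -mulrA mulrC (_ : _ * _ = eta ^+ 2 / K);
    last first.
    by field; rewrite gt_eqF.
  by rewrite ler_pdivrMr // mul1r lerDr dotp_ge0.
exists (ell_grad 0 1 x - c *: ell_grad p eta x) => z.
rewrite h_ball_ell dotpBl (dotpZl _ c) !dotpBr !dotp_ell_grad_id //.
rewrite -subr_ge0.
set g := ell_norm p eta z; set G := dotp (ell_grad p eta x) z.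
set a := ell_norm 0 1 z; set A := dotp (ell_grad 0 1 x) z.
suff : c * (g - G) <= a - A by lra.
have [z0|z0] := eqVneq z 0.
  by rewrite /g /G /a /A z0 !ell_norm0 !dotp0r !subr0 mulr0.
have x1 := ell_norm_gt0 0 o1 x0; have z1 := ell_norm_gt0 0 o1 z0.
have xe := ell_norm_gt0 p e0 x0.
(* With weights [|z|] and [|x|] the gap of the ball is exact, so both gaps are governed by quadratic
   forms in the same [y]. [ell_form_le] brings in [K], and [c * K = eta] leaves
   [eta * |x| <= ell_norm p eta x]. *)
rewrite /a /A ell_gap_eq //.
apply: le_trans (ler_wpM2l (ltW c0) (ell_gap_le p e0 z x0 z1 x1)) _.
set y := _ - _; rewrite form1.
set al := ell_norm 0 1 x in x1 y *; set be := ell_norm 0 1 z in z1 y *.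
set xl := ell_norm p eta x in xe *.
have yy := dotp_ge0 y.
have D0 : 0 < 2 * (be * al) by rewrite !mulr_gt0.
apply: (@le_trans _ _ (c * (K * dotp y y / (2 * (be * al) * xl)))).
  rewrite ler_pM2l // ler_pM2r ?ell_form_le // invr_gt0.
  by apply: mulr_gt0 xe.
have -> : c * (K * dotp y y / (2 * (be * al) * xl)) =
          eta / xl * (dotp y y / (2 * (be * al))).
  by rewrite /c; field; rewrite !gt_eqF.
have -> : dotp y y / (2 * (be * al) * al) = al^-1 * (dotp y y / (2 * (be *
  al))).
  by field; rewrite !gt_eqF.
apply: ler_wpM2r; first by rewrite divr_ge0 // ltW.
rewrite ler_pdivrMr // mulrC ler_pdivlMr //.
rewrite -ler_sqr ?nnegrE ?pmulr_rge0 ?(ltW xe) ?(ltW x1) //.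
rewrite exprMn !ell_norm_sq // form1 /ell_form lerDr -expr2 sqr_ge0 //.
Qed.

(* Every coordinate of a unit vector is rounded towards zero to a multiple of
   [1/N], which keeps the point inside the unit ball. *)
Lemma ball_net (e : R) : 0 < e ->
  exists (I : finType) (_ : I) (F : I -> 'rV[R]_n),
    (forall a x, dotp (F a) x <= h_ball x) /\
    (forall x, exists a, h_ball x <= dotp (F a) x + e * `|x|).
Proof.
move=> e0.
(* Rounding loses at most [1/N] in each of the [n] coordinates, so [N] has to exceed [n / e]. *)
pose N := (Num.truncn (n%:R / e)).+1.
have N0 : 0 < N%:R :> R by rewrite ltr0n.
pose I := {ffun 'I_n -> 'I_N.+1 * bool}.
pose pt (k : I) : 'rV[R]_n := \row_i ((-1) ^+ (k i).2 * ((k i).1%:R / N%:R)).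
pose F (k : I) : 'rV[R]_n := if dotp (pt k) (pt k) <= 1 then pt k else 0.
exists I, [ffun => (ord0, false)], F; split=> [a x|x].
  rewrite /F; case: ifP => h; last by rewrite dotp0l sqrtr_ge0.
  apply: le_trans (dotp_le_h_ball _ _) _; rewrite ler_piMl ?sqrtr_ge0 //.
  by rewrite /h_ball -sqrtr1 ler_sqrt.
have [->|x0] := eqVneq x 0.
  exists [ffun => (ord0, false)].
  by rewrite /h_ball !dotp0r sqrtr0 normr0 mulr0 addr0.
have hx : 0 < h_ball x by rewrite h_ball_ell ell_norm_gt0 // ltr01.
have hx2 : h_ball x ^+ 2 = dotp x x by rewrite sqr_sqrtr // dotp_ge0.
pose u := (h_ball x)^-1 *: x.
have uu : dotp u u = 1.
  by rewrite dotpZl dotpZr -hx2; field; rewrite gt_eqF.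
have ux : dotp u x = h_ball x.
  by rewrite dotpZl -hx2; field; rewrite gt_eqF.
have u1 i : `|u ord0 i| <= 1.
  rewrite -(@ler_pXn2r _ 2) ?nnegrE ?expr1n // real_normK ?num_real // -uu.
  rewrite /dotp (bigD1 i) //= -expr2 lerDl sumr_ge0 // => l _.
  by rewrite -expr2 sqr_ge0.
pose k : I := [ffun i =>
  (inord (Num.truncn (N%:R * `|u ord0 i|)), u ord0 i < 0)].
have kE i : exists2 t : R, 0 <= t <= `|u ord0 i| &
    pt k ord0 i = (-1) ^+ (u ord0 i < 0)%R * t /\ `|u ord0 i| <= t + N%:R^-1.
  have Nu : 0 <= N%:R * `|u ord0 i| by rewrite mulr_ge0.
  have /andP[h1 h2] := truncn_itv Nu.
  exists ((Num.truncn (N%:R * `|u ord0 i|))%:R / N%:R).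
    by rewrite divr_ge0 ?ler0n //= ler_pdivrMr // [_ * N%:R]mulrC.
  split.
    rewrite mxE ffunE /= inordK // ltnS -(@ler_nat R); apply: le_trans h1 _.
    by rewrite ger_pMr.
  rewrite -[X in _ <= _ + X]mul1r -mulrDl ler_pdivlMr // mulrC natr1.
  exact: ltW.
have signE i : u ord0 i = (-1) ^+ (u ord0 i < 0)%R * `|u ord0 i|.
  by rewrite [LHS]numEsign.
have Fk : F k = pt k.
  rewrite /F ifT // -uu; apply: ler_sum => i _.
  have [t /andP[t0 tu] [-> _]] := kE i.
  rewrite mulrACA -expr2 sqrr_sign mul1r -!expr2 -[X in _ <= X]real_normK
    ?num_real //.
  by rewrite ler_pXn2r ?nnegrE.
exists k; rewrite Fk -ux -lerBlDl -dotpBl.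
apply: le_trans (ler_norm _) _.
apply: le_trans (ler_norm_sum _ _ _) _.
apply: (@le_trans _ _ (\sum_(i < n) N%:R^-1 * `|x|)).
  apply: ler_sum => i _; rewrite normrM ler_pM ?coord_le_norm //.
  have [t /andP[t0 tu] [E tN]] := kE i.
  rewrite mxE [X in _ + X]mxE E {1}signE -mulrBr normrM normr_sign mul1r.
  by rewrite ger0_norm ?subr_ge0 // lerBlDl.
rewrite sumr_const card_ord -[X in X <= _]mulr_natl mulrA ler_wpM2r //.
rewrite ler_pdivrMr // mulrC -ler_pdivrMr //.
by have /andP[_ /ltW] := truncn_itv (divr_ge0 (ler0n R n) (ltW e0)).
Qed.

End Ball.

(** * Exchanging the norm and absolute values of linear forms *)

Section Exchange.
Variables (R : realType) (n : nat).
Hypothesis n_gt0 : (0 < n)%N.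
Variable M : ('I_n -> 'rV[R]_n -> R) -> {measure set borelRV R n -> \bar R}.
Hypothesis HM : is_mixed_MA M.

Local Notation family := ('I_n -> 'rV[R]_n -> R).
Local Notation mixed := (mixed M).
Implicit Types (w u : family) (p : 'rV[R]_n) (r : R).

Definition abs_affine p (c : R) : 'rV[R]_n -> R := fun x => `|dotp p x + c|.

(** A maximum of linear forms is encoded as the value of the form that [m] selects; this form is a
    subgradient at [x]. *)
Lemma convex_of_dominating (I : finType) (F : I -> 'rV[R]_n)
    (m : 'rV[R]_n -> I) :
  (forall a x, dotp (F a) x <= dotp (F (m x)) x) ->
  convex_fun (fun x => dotp (F (m x)) x).
Proof.
move=> hm; apply: convex_of_subgradient => x; exists (F (m x)) => z.
by rewrite dotpBr addrC subrK.
Qed.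

(* For points [x] and [z], the pair [(m x, m z)] alone contributes enough to the
   sum of the absolute differences to compensate the maximum. *)
Lemma convex_pairs_sub_max (I : finType) (F : I -> 'rV[R]_n)
    (m : 'rV[R]_n -> I) :
  (forall a x, dotp (F a) x <= dotp (F (m x)) x) ->
  convex_fun (fun x =>
    \sum_(ab : I * I) abs_affine (F ab.1 - F ab.2) 0 x - dotp (F (m x)) x).
Proof.
move=> hm; apply: convex_of_subgradient => x.
pose t (ab : I * I) : R :=
  if dotp (F ab.1 - F ab.2) x < 0 then -1 else 1.
have t1 ab (z : R) : t ab * z <= `|z|.
  by rewrite /t; case: ifP => _; rewrite ?mulN1r ?mul1r ?ler_norm //
    ler_normr lexx orbT.
have tx ab : t ab * dotp (F ab.1 - F ab.2) x = `|dotp (F ab.1 - F ab.2) x|.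
  rewrite /t; case: ltP => h; first by rewrite mulN1r ltr0_norm.
  by rewrite mul1r ger0_norm.
pose P := \sum_(ab : I * I) t ab *: (F ab.1 - F ab.2).
have dP z : dotp P z = \sum_(ab : I * I) t ab * dotp (F ab.1 - F ab.2) z.
  rewrite /P (big_morph (fun q => dotp q z) (dotpDl z) (dotp0l z)).
  by apply: eq_bigr => ab _; rewrite dotpZl.
exists (P - F (m x)) => z; rewrite !(dotpBl, dotpBr).
have -> : \sum_(ab : I * I) abs_affine (F ab.1 - F ab.2) 0 x = dotp P x.
  by rewrite dP; apply: eq_bigr => ab _; rewrite tx /abs_affine addr0.
suff : dotp P z + dotp (F (m z)) z - dotp (F (m x)) z <=
       \sum_(ab : I * I) abs_affine (F ab.1 - F ab.2) 0 z.
  lra.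
rewrite dP (bigD1 (m x, m z)) //= [in leRHS](bigD1 (m x, m z)) //=.
have : \sum_(ab | ab != (m x, m z)) t ab * dotp (F ab.1 - F ab.2) z <=
       \sum_(ab | ab != (m x, m z)) abs_affine (F ab.1 - F ab.2) 0 z.
  by apply: ler_sum => ab _; rewrite /abs_affine addr0.
suff : t (m x, m z) * dotp (F (m x) - F (m z)) z + dotp (F (m z)) z
       - dotp (F (m x)) z <= abs_affine (F (m x) - F (m z)) 0 z by move=>
         /[swap]; lra.
(* At [x] the form of [m x] dominates, so this pair has sign 1 and its term cancels the two
   remaining terms. *)
rewrite /abs_affine addr0 /t /= ltNge dotpBl subr_ge0 hm /= mul1r dotpBl.
by have := normr_ge0 (dotp (F (m x)) z - dotp (F (m z)) z); lra.
Qed.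

Lemma mixed_abs_of_ball w i p x0 (r r' : R) : convex_family w -> r < r' ->
  mixed (upd w i (@h_ball R n)) (oball x0 r') = 0 ->
  mixed (upd w i (abs_affine p 0)) (oball x0 r) = 0.
Proof.
move=> cw rr' h0; apply: (mixed_approx0 n_gt0 HM cw _ rr').
  exact: convex_abs_affine.
move=> e e0; have [C C0 hC] := convex_bounded (r' + `|x0|) (@convex_h_ball R n).
(* [ell_norm p eta] exceeds [|<p, x>|] by at most [eta * |x|], which is at most [e] on the ball. *)
pose eta := e / (C + 1); have C1 : 0 < C + 1 by lra.
have eta0 : 0 < eta by rewrite divr_gt0.
exists (ell_norm p eta); split; first exact: convex_ell_norm.
- move=> x xr; have hx := hC x (le_norm_center xr).
  have h1 : 0 <= h_ball x by exact: sqrtr_ge0.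
  rewrite ger0_norm // in hx.
  have h2 : eta * h_ball x <= e.
    apply: (@le_trans _ _ (eta * C)); first by rewrite ler_pM2l.
    by rewrite /eta mulrAC ler_pdivrMr // ler_pM2l //; lra.
  have a0 := normr_ge0 (dotp p x); have g0 := ell_norm_ge0 p eta x.
  have gsq : ell_norm p eta x ^+ 2 = `|dotp p x| ^+ 2 + (eta * h_ball x) ^+ 2.
    rewrite ell_norm_sq // real_normK ?num_real //
      exprMn sqr_sqrtr ?dotp_ge0 //.
  have g1 : `|dotp p x| <= ell_norm p eta x.
    by rewrite -ler_sqr ?nnegrE // gsq lerDl sqr_ge0.
  have g2 : ell_norm p eta x <= `|dotp p x| + eta * h_ball x.
    rewrite -ler_sqr ?nnegrE ?addr_ge0 ?(mulr_ge0 (ltW eta0)) // gsq sqrrD.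
    by rewrite lerD2r lerDl mulrn_wge0 // mulr_ge0 // mulr_ge0 // ltW.
  by rewrite /abs_affine addr0 ger0_norm ?subr_ge0 //; lra.
set c := eta / (dotp p p + eta ^+ 2).
have c0 : 0 < c.
  by rewrite divr_gt0 // ltr_wpDl ?dotp_ge0 // exprn_gt0.
apply: (@mixed_upd_summand0 _ _ n_gt0 _ HM w i _ _
  (fun x => h_ball x - c * ell_norm p eta x) c 1) => //.
- exact: oball_borel.
- exact: convex_ell_norm.
- exact: convex_ball_sub_ell.
rewrite -[RHS]h0; congr (mixed (upd _ _ _) _); apply/funext => x.
by rewrite mul1r addrC subrK.
Qed.

Lemma mixed_ball_of_abs w i x0 (r r' : R) : convex_family w -> r < r' ->
  (forall p, mixed (upd w i (abs_affine p 0)) (oball x0 r') = 0) ->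
  mixed (upd w i (@h_ball R n)) (oball x0 r) = 0.
Proof.
move=> cw rr' h0; apply: (mixed_approx0 n_gt0 HM cw _ rr').
  exact: convex_h_ball.
move=> e e0; pose C := `|r'| + `|x0| + 1.
have C0 : 0 < C by rewrite ltr_wpDl ?addr_ge0.
have [I [a0 [F [F1 F2]]]] := ball_net n (divr_gt0 e0 C0).
pose m x := [arg max_(a > a0) dotp (F a) x]%O.
have hm a x : dotp (F a) x <= dotp (F (m x)) x.
  by rewrite /m; case: arg_maxP => //= b _; apply.
exists (fun x => dotp (F (m x)) x); split.
- exact: convex_of_dominating.
- move=> x xr; have xC : `|x| <= C.
    apply: le_trans (le_norm_center xr) _; rewrite /C.
    by have := ler_norm r'; lra.
  have [a ha] := F2 x; have := F1 (m x) x; have := hm a x.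
  have : e / C * `|x| <= e.
    by rewrite mulrAC ler_pdivrMr // ler_pM2l.
  by move=> h1 h2 h3; rewrite distrC ger0_norm ?subr_ge0 //; lra.
apply: (@mixed_upd_summand0 _ _ n_gt0 _ HM w i _ _ (fun x =>
  \sum_(ab : I * I) abs_affine (F ab.1 - F ab.2) 0 x - dotp (F (m x)) x) 1 1);
  rewrite ?ltr01 ?ler01 //.
- exact: oball_borel.
- exact: convex_of_dominating.
- exact: convex_pairs_sub_max.
rewrite (_ : (fun x => _) = fun x =>
    \sum_(ab : I * I) abs_affine (F ab.1 - F ab.2) 0 x); last first.
  by apply/funext => x; rewrite !mul1r addrC subrK.
apply: (mixed_upd_sum0 n_gt0 HM) => //; first exact: oball_borel.
by move=> ab; exact: convex_abs_affine.
Qed.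

(* Replaces the entries of [w] by those of [w'] one at a time, shrinking the
   ball a little at every step. *)
Lemma mixed_chain w w' x0 (r r' : R) : convex_family w -> convex_family w' ->
  r < r' ->
  (forall u i (s s' : R), convex_family u ->
     (forall l, u l = w l \/ u l = w' l) -> u i = w i -> s < s' ->
     mixed u (oball x0 s') = 0 -> mixed (upd u i (w' i)) (oball x0 s) = 0) ->
  mixed w (oball x0 r') = 0 -> mixed w' (oball x0 r) = 0.
Proof.
move=> cw cw' rr' step h0.
pose mix (s : nat) : family := fun l => if (l < s)%N then w' l else w l.
have cmix s : convex_family (mix s) by move=> l; rewrite /mix; case: ifP.
suff H s : (s <= n)%N -> forall t, t < r' -> mixed (mix s) (oball x0 t) = 0.
  rewrite (_ : w' = mix n); first exact: H.
  by apply/funext => l; rewrite /mix ltn_ord.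
elim: s => [_ t tr|s IH sn t tr].
  rewrite (_ : mix 0%N = w); last by apply/funext.
  apply: (mixed_sub0 n_gt0 HM cw _ _ _ h0); try exact: oball_borel.
  by move=> x; rewrite /oball /= => /lt_trans; apply.
pose i := Ordinal sn.
have tm : t < (t + r') / 2 by lra.
have := step (mix s) i t ((t + r') / 2) (cmix s) _ _ tm _.
rewrite (_ : upd _ _ _ = mix s.+1); last first.
  apply/funext => l; rewrite /upd /mix [in RHS]ltnS [in RHS]leq_eqVlt.
  have [->|li] := eqVneq l i; first by rewrite eqxx.
  by rewrite (_ : (val l == s) = (l == i)) // (negPf li).
apply.
- by move=> l; rewrite /mix; case: ifP; [right|left].
- by rewrite /mix ltnn.
- by apply: IH; [exact: ltnW|lra].
Qed.

Variable v : 'rV[R]_n -> R.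
Hypothesis cv : convex_fun v.

Definition abs_family (k : nat) (f : 'I_n -> 'rV[R]_n) : family :=
  fun l => if (l < k)%N then v else abs_affine (f l) 0.

Lemma convex_abs_family k f : convex_family (abs_family k f).
Proof. by move=> l; rewrite /abs_family; case: ifP => // _;
  exact: convex_abs_affine. Qed.

Lemma convex_rep_ball k : convex_family (rep_ball k v).
Proof. by move=> l; rewrite /rep_ball; case: ifP => // _;
  exact: convex_h_ball. Qed.

Lemma abs_family_of_ball k f x0 (r r' : R) : r < r' ->
  mixed (rep_ball k v) (oball x0 r') = 0 ->
  mixed (abs_family k f) (oball x0 r) = 0.
Proof.
move=> rr'; apply: mixed_chain => //;
  [exact: convex_rep_ball|exact: convex_abs_family|].
move=> u i s s' cu _ ui ss' u0; rewrite /abs_family; case: ifP => ik.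
  have -> : upd u i v = u by rewrite -[RHS](upd_id u i) ui /rep_ball ik.
  apply: (mixed_sub0 n_gt0 HM cu _ _ _ u0); try exact: oball_borel.
  by move=> x; rewrite /oball /= => /lt_trans; apply.
apply: (@mixed_abs_of_ball _ _ _ _ _ s') => //.
by rewrite (_ : @h_ball R n = u i) ?upd_id // ui /rep_ball ik.
Qed.

(** Restoring one norm requires vanishing for every form in that entry. The induction therefore
    keeps [f] universally quantified, which [mixed_chain] does not provide. *)
Lemma ball_of_abs_family k x0 (r r' : R) : r < r' ->
  (forall f, mixed (abs_family k f) (oball x0 r') = 0) ->
  mixed (rep_ball k v) (oball x0 r) = 0.
Proof.
move=> rr' h0.
pose mix (s : nat) (f : 'I_n -> 'rV[R]_n) : family := fun l =>
  if (l < k)%N then v else if (l < s)%N then abs_affine (f l) 0 else @h_ball R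
    n.
have cmix s f : convex_family (mix s f).
  move=> l; rewrite /mix; case: ifP => // _.
  by case: ifP => _; [exact: convex_abs_affine|exact: convex_h_ball].
suff H s : (s <= n)%N -> forall t f, t < r' ->
  mixed (mix (n - s)%N f) (oball x0 t) = 0.
  have := H n (leqnn n) r (fun=> 0) rr'; rewrite subnn.
  by congr (mixed _ _ = _); apply/funext => l; rewrite /mix /rep_ball;
    case: ifP.
elim: s => [_ t f tr|s IH sn t f tr].
  rewrite subn0; have -> : mix n f = abs_family k f.
    by apply/funext => l; rewrite /mix /abs_family ltn_ord.
  apply: (mixed_sub0 n_gt0 HM _ _ _ _ (h0 f)); try exact: oball_borel.
    exact: convex_abs_family.
  by move=> x; rewrite /oball /= => /lt_trans; apply.
have mn : (n - s.+1 < n)%N by rewrite ltn_subrL.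
pose i := Ordinal mn.
have ltE (l : 'I_n) :
    (l < n - s)%N = (val l == (n - s.+1)%N) || (l < n - s.+1)%N.
  by rewrite -subnSK // ltnS leq_eqVlt.
have tm : t < (t + r') / 2 by lra.
have tm' : (t + r') / 2 < r' by lra.
have [ik|ki] := boolP (i < k)%N.
  have -> : mix (n - s.+1)%N f = mix (n - s)%N f.
    apply/funext => l; rewrite /mix ltE.
    case: ifP => // lk; case: (val l =P (n - s.+1)%N) => [li|_] /=.
      by case/negP: (negbT lk); rewrite li.
    by [].
  by apply: IH => //; exact: ltnW.
have -> : mix (n - s.+1)%N f = upd (mix (n - s.+1)%N f) i (@h_ball R n).
  rewrite -[LHS](upd_id _ i); congr (upd _ _ _).
  by rewrite /mix (negPf ki) ltnn.
apply: (@mixed_ball_of_abs _ _ _ _ ((t + r') / 2)) => // p.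
have := IH (ltnW sn) _ (fun l => if l == i then p else f l) tm'.
congr (mixed _ _ = _); apply/funext => l; rewrite /upd /mix ltE.
rewrite (_ : (val l == (n - s.+1)%N) = (l == i)) //.
by have [->|] := eqVneq l i; first by rewrite (negPf ki).
Qed.

End Exchange.

(** * Points of isolated contact *)

Section Contact.
Variables (R : realType) (n : nat).
Hypothesis n_gt0 : (0 < n)%N.
Variable M : ('I_n -> 'rV[R]_n -> R) -> {measure set borelRV R n -> \bar R}.
Hypothesis HM : is_mixed_MA M.

Local Notation family := ('I_n -> 'rV[R]_n -> R).
Local Notation mixed := (mixed M).
Implicit Types (w u : family) (p : 'rV[R]_n) (r : R).

Lemma MA_sum1 w B : convex_family w -> measurable (B : set (borelRV R n)) ->
  MA (fun x => \sum_i w i x) B =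
  (\sum_(f : {ffun 'I_n -> 'I_n}) M (fun l => w (f l)) B)%E.
Proof.
move=> cw mB.
have -> : (fun x => \sum_i w i x) = fun x => \sum_i (fun=> 1) i * w i x.
  by apply/funext => x; apply: eq_bigr => i _; rewrite mul1r.
rewrite (MA_sum HM) //; apply: eq_bigr => f _.
by rewrite big1 // mul1e.
Qed.

(* Additivity of the mixed measures makes the gradient image of [A] disjoint
   from that of [S] up to a null set, so it cannot be contained in it. *)
Lemma subdiff_avoids w A S : convex_family w -> bounded_borel A ->
  bounded_borel S -> A `&` S = set0 -> mixed w A != 0 ->
  exists b y, [/\ A b, subdiff (fun x => \sum_i w i x) b y &
    forall z, S z ->
      \sum_i w i b + dotp y (z - b) < \sum_i w i z].
Proof.
move=> cw bA bS AS wA; set W := fun x => \sum_i w i x.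
have cW : convex_fun W by exact: convex_sum.
have [mA mS] := (bA.1, bS.1).
suff [y Wy nWy] : exists2 y, (\bigcup_(b in A) subdiff W b) y &
    ~ (\bigcup_(b in S) subdiff W b) y.
  have [b Ab hy] := Wy; exists b, y; split => // z Sz.
  rewrite lt_neqAle hy andbT; apply/eqP => E; apply: nWy; exists z => // x.
  by rewrite /W -E; have := hy x; rewrite /W !dotpBr; lra.
apply: contrapT => h.
have sub : \bigcup_(b in A) subdiff W b `<=` \bigcup_(b in S) subdiff W b.
  by move=> y Ay; apply: contrapT => Sy; apply: h; exists y.
(* Each term of the expansion is a measure, whence additivity; as the image of [A] is contained in
   that of [S], it forces [MA W A = 0]. *)
have : (MA W (A `|` S) = MA W A + MA W S)%E.
  rewrite !MA_sum1 //; last exact: measurableU.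
  by rewrite -big_split /=; apply: eq_bigr => f _; exact: measureU.
have -> : MA W (A `|` S) = MA W S.
  rewrite /MA bigcup_setU; congr lebesgue_outer.
  exact/setUidPr.
have := MA_fin n_gt0 cW bA; have := MA_fin n_gt0 cW bS.
have := M_le_MA HM cw mA; rewrite (mixedE n_gt0 HM) // -/W.
case: (MA W A) => // a; case: (MA W S) => // s; rewrite lee_fin => wa _ _ [E].
have a0 : a = 0 by lra.
by move: wA; rewrite eq_le (mixed_ge0 M) -a0 wa.
Qed.

Variable v : 'rV[R]_n -> R.
Hypothesis cv : convex_fun v.

Definition forms_kernel (k : nat) (f : 'I_n -> 'rV[R]_n) : set 'rV[R]_n :=
  [set x | forall l : 'I_n, (k <= l)%N -> dotp (f l) x = 0].

Lemma closed_hyperplane p (c : R) : closed [set x | dotp p x = c].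
Proof.
rewrite (_ : [set _ | _] = (fun x => dotp p x + 0) @^-1` [set c]); last first.
  by apply/seteqP; split=> x /=; rewrite addr0.
apply: closed_comp; last exact: closed_eq.
by move=> x _; exact: (convex_continuous (convex_affine p 0)).
Qed.

(** Off the hyperplane of [f i] the entry [|<f i, .>|] is locally affine, so no mass lies there. The
    hyperplanes are intersected one by one; [A s] records those of index below [s]. *)
Lemma abs_family_concentrated k f (x0 : 'rV[R]_n) r :
  mixed (abs_family v k f) (oball x0 r) != 0 ->
  bounded_borel (oball x0 r `&` forms_kernel k f) /\
  mixed (abs_family v k f) (oball x0 r `&` forms_kernel k f) != 0.
Proof.
set w := abs_family v k f => w0.
have cw : convex_family w by exact: convex_abs_family.
pose A (s : nat) := oball x0 r `&`
  [set x | forall l : 'I_n, (k <= l < s)%N -> dotp (f l) x = 0].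
have Ar s x : A s x -> `|x| <= r + `|x0|.
  by move=> [xr _]; exact/le_norm_center/ltW.
suff H s : (s <= n)%N -> bounded_borel (A s) /\ mixed w (A s) != 0.
  rewrite (_ : _ `&` _ = A n); first exact: H.
  congr (_ `&` _); apply/seteqP; split=> x /= h l; last first.
    by move=> kl; apply: h; rewrite kl ltn_ord.
  by move=> /andP[kl _]; apply: h.
elim: s => [_|s IH sn].
  rewrite (_ : A 0%N = oball x0 r); first by split=> //; exact: oball_borel.
  apply/seteqP; split=> x; first by case.
  by move=> xr; split=> // l; rewrite andbF.
have [bA mA] := IH (ltnW sn).
pose i := Ordinal sn.
have [ks|sk] := leqP k s; last first.
  rewrite (_ : A s.+1 = A s) //; congr (_ `&` _).
  apply/seteqP; split=> x /= h l /andP[kl ls]; apply: h.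
    by rewrite kl ltnW.
  by rewrite kl /=; move: (leq_ltn_trans (leq_trans sk kl) (ls)); rewrite ltnn.
have AS : A s.+1 = A s `&` [set x | dotp (f i) x = 0].
  apply/seteqP; split=> x /= => [[xr h]|[[xr h] h0]].
    split; last by apply: h; rewrite ks /=.
    by split=> // l /andP[kl ls]; apply: h; rewrite kl ltnW.
  split=> // l /andP[kl]; rewrite ltnS leq_eqVlt => /orP[/eqP ls|ls].
    by rewrite (_ : l = i) //; exact: val_inj.
  by apply: h; rewrite kl.
have bA' : bounded_borel (A s.+1).
  split; last by exists (r + `|x0|); exact: Ar.
  rewrite AS; apply: measurableI; first by case: bA.
  rewrite -[X in measurable X]setCK; apply: measurableC.
  by apply: sub_sigma_algebra; apply: closed_openC; exact: closed_hyperplane.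
split=> //; apply: contra_neq mA => mA'.
have cL : continuous (fun x => dotp (f i) x + 0).
  by apply: convex_continuous; exact: convex_affine.
pose O2 := oball x0 r `&` [set x | 0 < dotp (f i) x + 0].
pose O3 := oball x0 r `&` [set x | dotp (f i) x + 0 < 0].
have oO2 : open O2.
  apply: openI; first exact: open_oball.
  apply: (@open_comp _ _ (fun x => dotp (f i) x + 0) [set t | 0 < t]) => [x _|].
    exact: cL.
  exact: open_gt.
have oO3 : open O3.
  apply: openI; first exact: open_oball.
  apply: (@open_comp _ _ (fun x => dotp (f i) x + 0) [set t | t < 0]) => [x _|].
    exact: cL.
  exact: open_lt.
have O2b x : O2 x -> `|x| <= r + `|x0| by move=> [/ltW/le_norm_center].
have O3b x : O3 x -> `|x| <= r + `|x0| by move=> [/ltW/le_norm_center].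
have wi : w i = abs_affine (f i) 0 by rewrite /w /abs_family ltnNge ks.
have bO2 := open_borel oO2 O2b; have bO3 := open_borel oO3 O3b.
apply: (@mixed_sub0 _ _ n_gt0 _ HM _ _ (A s.+1 `|` (O2 `|` O3))) => //.
- by apply: bounded_borelU => //; exact: bounded_borelU.
- move=> x [xr h]; have [l0|l0|l0] := ltgtP 0 (dotp (f i) x + 0).
  + by right; left.
  + by right; right.
  + by left; rewrite AS; split=> //=; rewrite [RHS]l0 addr0.
apply: (mixedU0 n_gt0 HM) => //; first exact: bounded_borelU.
apply: (mixedU0 n_gt0 HM) => //.
- apply: (@mixed_affine0 _ _ n_gt0 _ HM _ i _ _ (f i) 0 cw oO2 O2b) =>
  x [_ /= h].
  by rewrite wi /abs_affine gtr0_norm.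
- apply: (@mixed_affine0 _ _ n_gt0 _ HM _ i _ _ (- f i) 0 cw oO3 O3b) =>
  x [_ /= h].
  by rewrite wi /abs_affine ltr0_norm // dotpNl opprD oppr0.
Qed.

Lemma sphere_borel (x0 : 'rV[R]_n) r : bounded_borel [set x | `|x - x0| = r].
Proof.
split; last by exists (r + `|x0|) => x /= h; apply: le_norm_center; rewrite h.
rewrite -[X in measurable X]setCK; apply: measurableC; apply: sub_sigma_algebra.
apply: closed_openC.
rewrite (_ : [set _ | _] = (fun x => `|x - x0|) @^-1` [set r]) //.
apply: closed_comp; last exact: closed_eq.
by move=> x _; exact: (convex_continuous (convex_dist x0)).
Qed.

(** [subdiff_avoids] compares the part of the ball in the kernel with the sphere. On the kernel the
    absolute values vanish, and only the copies of [v] remain in the sum of the entries. *)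
Lemma exposed_point k f (x0 : 'rV[R]_n) (r1 r2 : R) :
  r1 <= r2 -> mixed (abs_family v k f) (oball x0 r1) != 0 ->
  exists b y, [/\ `|b - x0| < r1, forms_kernel k f b &
    forall z, `|z - x0| = r2 -> forms_kernel k f z ->
      \sum_(l < n | (l < k)%N) v b + dotp y (z - b) <
      \sum_(l < n | (l < k)%N) v z].
Proof.
move=> r12 w0; have [bA wA] := abs_family_concentrated w0.
have cw : convex_family (abs_family v k f) by exact: convex_abs_family.
have sumE x : forms_kernel k f x ->
    \sum_l abs_family v k f l x = \sum_(l < n | (l < k)%N) v x.
  move=> fx; rewrite [RHS]big_mkcond; apply: eq_bigr => l _.
  rewrite /abs_family; case: ltnP => // kl.
  by rewrite /abs_affine fx // addr0 normr0.
have [|b [y [[br fb] _ h]]] := subdiff_avoids cw bA (sphere_borel x0 r2) _ wA.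
  apply/seteqP; split=> // x [[xr _] /= xr2].
  by move: xr; rewrite /oball /= xr2 ltNge r12.
exists b, y; split=> // z zr fz.
by rewrite -(sumE b) // -(sumE z) //; exact: h.
Qed.

End Contact.

(** * Polyhedral modification *)

Section Basis.
Variables (F : fieldType) (n : nat).

Lemma mx_between (U V : 'M[F]_n) (j : nat) :
  (U <= V)%MS -> (\rank U <= j <= \rank V)%N ->
  exists G : 'M[F]_n, [/\ (U <= G)%MS, (G <= V)%MS & \rank G = j].
Proof.
move=> UV /andP[]; elim: j => [|j IH].
  by rewrite leqn0 => /eqP rU _; exists U.
rewrite leq_eqVlt => /orP[/eqP rU _|]; first by exists U.
rewrite ltnS => rU jV; have [G [UG GV rG]] := IH rU (ltnW jV).
have /row_subPn[i VG] : ~~ (V <= G)%MS.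
  by apply/negP => /mxrankS; rewrite rG leqNgt jV.
exists (G + row i V)%MS; split.
- exact: submx_trans UG (addsmxSl _ _).
- by rewrite addsmx_sub GV row_sub.
apply/eqP; rewrite eqn_leq; apply/andP; split.
  apply: leq_trans (mxrank_adds_leqif _ _).1 _.
  by rewrite rG -[j.+1]addn1 leq_add2l rank_leq_row.
rewrite -{1}rG; suff : (G < G + row i V)%MS by rewrite ltmxErank => /andP[].
rewrite ltmxE addsmxSl /=; apply: contra VG; apply: submx_trans.
exact: addsmxSr.
Qed.

(* The columns of [Q] are the basis dual to one adapted to the flag of the line
   through [b] in the left kernel of [A]. *)
Lemma adapted_basis (A : 'M[F]_n) (b : 'rV[F]_n) (j k : nat) :
  (1 <= j)%N -> (j <= k)%N -> (k <= n)%N ->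
  (forall i l : 'I_n, (l < k)%N -> A i l = 0) -> b *m A = 0 ->
  exists2 Q : 'M[F]_n, Q \in unitmx &
    (forall l : 'I_n, (j <= l)%N -> (b *m Q) ord0 l = 0) /\
    (forall x : 'rV[F]_n, (forall l : 'I_n, (j <= l)%N ->
      (x *m Q) ord0 l = 0) ->
       x *m A = 0).
Proof.
move=> j1 jk kn A0 bA.
have rA : (\rank A <= n - k)%N.
  rewrite -(rank_copid_mx F kn) (_ : A = A *m copid_mx k) ?mxrankM_maxr //.
  apply/matrixP => i l; rewrite /copid_mx mulmxBr mulmx1 !mxE big1 ?subr0 // =>
    m _.
  rewrite mxE; have [->|ml] := eqVneq m l;
    last by rewrite (_ : _ == _ = false) ?mulr0 //; apply/negbTE.
  by case: ltnP => lk; rewrite ?eqxx ?andbF ?mulr0 // A0 // mul0r.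
have [||G [bG GA rG]] := @mx_between <<b>>%MS (kermx A) j _ _.
- by rewrite genmxE; apply/sub_kermxP.
- rewrite genmxE (leq_trans (rank_leq_row b)) //= mxrank_ker.
  by rewrite leq_subRL ?rank_leq_row // (leq_trans (leq_add rA jk)) // subnK.
(* The first [j] rows of [row_ebase G] span [G], so [x] is in [G] exactly when the coordinates of
   [x *m invmx Q] from [j] on vanish; the witness is this inverse. *)
pose Q := row_ebase G; have uQ : Q \in unitmx by exact: row_ebase_unit.
have sub_pid (x : 'rV[F]_n) : (x <= G)%MS = (x <= (pid_mx j : 'M[F]_(j, n)) *m
  Q)%MS.
  by rewrite -(eq_row_base G) /row_base rG.
exists (invmx Q); first by rewrite unitmx_inv.
split=> [l jl|x h].
  have /submxP[c ->] : (b <= (pid_mx j : 'M[F]_(j, n)) *m Q)%MS.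
    by rewrite -sub_pid -(genmxE b).
  rewrite mulmxA mulmxK // mxE big1 // => i _.
  by rewrite mxE (_ : _ == _ = false) ?mulr0 //; apply/negbTE;
    rewrite neq_ltn (leq_trans _ jl).
apply/sub_kermxP; apply: submx_trans GA; rewrite sub_pid.
have jn := leq_trans jk kn.
apply/submxP; exists (x *m invmx Q *m (pid_mx j : 'M[F]_(n, j))).
rewrite -!mulmxA [_ *m (_ *m Q)]mulmxA pid_mx_id // !mulmxA.
suff E : x *m invmx Q *m (pid_mx j : 'M[F]_n) = x *m invmx Q.
  by rewrite E mulmxKV.
apply/rowP => l; rewrite mxE (bigD1 l) //= big1 ?addr0 => [|i /negPf il].
  rewrite [X in _ * X]mxE eqxx /=; case: ltnP => lj; first by rewrite mulr1.
  by rewrite mulr0 h.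
by rewrite [X in _ * X]mxE (_ : _ == _ = false) ?mulr0.
Qed.

End Basis.

(** * Positivity on a compact set by penalization *)

Section Penalty.
Variables (R : realType) (n : nat).
Implicit Types (x b z : 'rV[R]_n).

(** On the compact set [K] where [f] is nonpositive, [g] has a positive minimum [g c]; the factor
    [(|f d| + 1) / g c] lifts the penalty there above [- f], because [f d] is the minimum of [f] on
    [S]. *)
Lemma compact_penalty (S : set 'rV[R]_n) (f g : 'rV[R]_n -> R) :
  compact S -> closed S -> convex_fun f -> convex_fun g ->
    (forall z, 0 <= g z) ->
  (forall z, S z -> g z = 0 -> 0 < f z) ->
  exists s e, [/\ 0 <= s, 0 < e & forall z, S z -> e <= f z + s * g z].
Proof.
move=> cS clS vf vg g0 fg.
have cf := convex_continuous vf; have cg := convex_continuous vg.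
have cwithin (h : 'rV[R]_n -> R) (A : set 'rV[R]_n) :
    continuous h -> {within A, continuous h}.
  by move=> ch; apply: continuous_subspaceT.
have [S0|/set0P S0] := eqVneq S set0.
  by exists 0, 1; split=> // z; rewrite S0.
suff [s s0 pos] : exists2 s, 0 <= s & forall z, S z -> 0 < f z + s * g z.
  have ch : continuous (fun z => f z + s * g z).
    by apply: convex_continuous; apply: convex_add => //; exact: convex_scale.
  have [c cS' cmin] := compact_EVT_min S0 cS (cwithin _ _ ch).
  exists s, (f c + s * g c); split=> //; first by apply: pos;
    rewrite inE in cS'.
  by move=> z Sz; apply: cmin; rewrite inE.
pose K := S `&` [set z | f z <= 0].
have [K0|/set0P K0] := eqVneq K set0.
  exists 0 => // z Sz; rewrite mul0r addr0 ltNge; apply/negP => fz.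
  by have : K z by []; rewrite K0.
have cK : compact K.
  apply: (subclosed_compact _ cS); last by move=> z [].
  apply: closedI => //.
  rewrite (_ : [set _ | _] = f @^-1` [set t | t <= 0]) //.
  apply: closed_comp; last exact: closed_le.
  by move=> z _; exact: cf.
have [c cK' cmin] := compact_EVT_min K0 cK (cwithin _ _ cg).
have [d dS dmin] := compact_EVT_min S0 cS (cwithin _ _ cf).
rewrite inE in cK'.
have gc : 0 < g c.
  rewrite lt_neqAle g0 andbT eq_sym; apply/eqP => gc0.
  by case: cK' => Sc /=; rewrite leNgt fg.
exists ((`|f d| + 1) / g c) => [|z Sz].
  by rewrite divr_ge0 ?addr_ge0 // ltW.
have [fz|fz] := ltP 0 (f z).
  by rewrite ltr_pwDl // mulr_ge0 // divr_ge0 ?addr_ge0 // ltW.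
have gz : g c <= g z by apply: cmin; rewrite inE.
have fd : f d <= f z by apply: dmin; rewrite inE.
have : (`|f d| + 1) / g c * g c <= (`|f d| + 1) / g c * g z.
  by rewrite ler_wpM2l // divr_ge0 ?addr_ge0 // ltW.
rewrite mulfVK ?gt_eqF //.
have := ler_norm (- f d); rewrite normrN; lra.
Qed.

Lemma segment_meets_sphere b x (x0 : 'rV[R]_n) (r : R) :
  `|b - x0| < r -> r <= `|x - x0| ->
  exists2 t, 0 < t <= 1 & `|b + t *: (x - b) - x0| = r.
Proof.
move=> br xr; pose h (t : R) := `|b + t *: (x - b) - x0|.
have h0 : h 0 = `|b - x0| by rewrite /h scale0r addr0.
have h1 : h 1 = `|x - x0| by rewrite /h scale1r subrKC.
have ch : continuous h.
  move=> t; rewrite /h; apply: cvg_norm; apply: cvgB; last exact: cvg_cst.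
  by apply: cvgD; [exact: cvg_cst|apply: cvgZr_tmp; exact: cvg_id].
have [||t] := @IVT R h 0 1 r ler01.
- by apply: continuous_subspaceT.
- rewrite h0 h1 ge_min le_max xr orbT andbT; apply/orP; left; exact: ltW.
rewrite in_itv /= => /andP[t0 t1] ht; exists t => //.
rewrite t1 andbT lt_neqAle t0 andbT; apply/eqP => tE.
by move: br; rewrite -ht -tE h0 ltxx.
Qed.

End Penalty.

(** * From isolated contact to positive mass *)

Section Localization.
Variables (R : realType) (n : nat).
Hypothesis n_gt0 : (0 < n)%N.
Variable M : ('I_n -> 'rV[R]_n -> R) -> {measure set borelRV R n -> \bar R}.
Hypothesis HM : is_mixed_MA M.

Local Notation family := ('I_n -> 'rV[R]_n -> R).
Local Notation mixed := (mixed M).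

Definition col_form (Q : 'M[R]_n) (l : 'I_n) : 'rV[R]_n := \row_i Q i l.

Lemma dotp_col_form Q l (x : 'rV[R]_n) : dotp (col_form Q l) x = (x *m Q) ord0
  l.
Proof. by rewrite mxE; apply: eq_bigr => i _; rewrite mxE mulrC. Qed.

(** In the expansion of [MA] of the sum, selections with a repetition vanish by [mixed_repeat0] and
    the bijective ones all equal the mass in question. The sum has a vertex at [b], where its
    subdifferential contains a cube around 0. *)
Lemma mixed_basis_neq0 (Q : 'M[R]_n) (b : 'rV[R]_n) (r : R) :
  Q \in unitmx -> 0 < r ->
  mixed (fun l => abs_affine (col_form Q l) (- dotp (col_form Q l) b)) (oball b
    r) != 0.
Proof.
move=> uQ r0; set G := fun l => _; apply/eqP => G0.
have cG : convex_family G by move=> l; exact: convex_abs_affine.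
have GE l x : G l x = `|dotp (col_form Q l) (x - b)|.
  by rewrite /G /abs_affine dotpBr.
have bB : bounded_borel (oball b r) by exact: oball_borel.
suff : (0 < MA (fun x => (\sum_l G l x)%R) (oball b r))%E.
  rewrite (MA_sum1 HM) //; last by case: bB.
  rewrite big1 ?ltxx // => f _; rewrite (mixedE n_gt0 HM) //; congr (_%:E).
  have [/injectiveP fi|/injectivePn[l [l' ll' fl]]] := boolP (injectiveb f).
    rewrite -[RHS]G0 -[RHS](mixed_perm HM (perm fi)) //; congr (mixed _ _).
    by apply/funext => l; rewrite /= permE.
  apply: (@mixed_repeat0 _ _ n_gt0 _ HM _ l l' _ _ (col_form Q (f l))
    (- dotp (col_form Q (f l)) b)) => //.
  by rewrite -fl.
(* If the coordinates of [y] are at most [1 / C], its coefficients in the basis of the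
   [col_form Q l] are at most 1, which makes [y] a subgradient at [b]. *)
pose C := 1 + \sum_l \sum_i `|invmx Q l i|.
have S0 : 0 <= \sum_l \sum_i `|invmx Q l i|.
  by apply: sumr_ge0 => l _; exact: sumr_ge0.
have C0 : 0 < C by rewrite /C; lra.
apply: (@lebesgue_outer_box_gt0 _ _ _ C^-1); first by rewrite invr_gt0.
move=> y hy; exists b; first by rewrite /oball /= subrr normr0.
move=> x; rewrite big1 ?add0r => [|l _]; last by rewrite GE subrr dotp0r normr0.
pose t : 'rV[R]_n := y *m (invmx Q)^T.
have tE l : `|t ord0 l| <= 1.
  rewrite mxE; apply: le_trans (ler_norm_sum _ _ _) _.
  apply: (@le_trans _ _ (\sum_i C^-1 * `|invmx Q l i|)).
    by apply: ler_sum => i _; rewrite normrM mxE ler_wpM2r.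
  rewrite -mulr_sumr mulrC ler_pdivrMr // mul1r /C [in leRHS](bigD1 l) //=.
  have : 0 <= \sum_(i < n | i != l) \sum_j `|invmx Q i j|.
    by apply: sumr_ge0 => i _; exact: sumr_ge0.
  by lra.
have -> : dotp y (x - b) = \sum_l t ord0 l * dotp (col_form Q l) (x - b).
  transitivity (((x - b) *m y^T) ord0 ord0).
    by rewrite mxE; apply: eq_bigr => i _; rewrite !mxE mulrC.
  transitivity (((x - b) *m Q *m t^T) ord0 ord0).
    by rewrite /t trmx_mul trmxK mulmxA mulmxK.
  by rewrite mxE; apply: eq_bigr => l _;
    rewrite dotp_col_form [t^T _ _]mxE mulrC.
apply: ler_sum => l _; rewrite GE; apply: le_trans (ler_norm _) _.
by rewrite normrM ler_piMl.
Qed.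

Variable v : 'rV[R]_n -> R.
Hypothesis cv : convex_fun v.

(* The entries [v] are replaced by [c v + s g] up to an affine function, which is
   positive on the sphere and zero at [b]; then, by [mixed_shell], by a
   function that is polyhedral near [b]. *)
Lemma exposed_mixed_neq0 (j : nat) (Q : 'M[R]_n) (b y x0 : 'rV[R]_n)
    (c r2 r4 : R) :
  Q \in unitmx -> 0 < c -> r2 < r4 -> `|b - x0| < r2 ->
  (forall l : 'I_n, (j <= l)%N -> dotp (col_form Q l) b = 0) ->
  (forall z, `|z - x0| = r2 ->
     (forall l : 'I_n, (j <= l)%N -> dotp (col_form Q l) z = 0) ->
     c * v b + dotp y (z - b) < c * v z) ->
  mixed (abs_family v j (col_form Q)) (oball x0 r4) != 0.
Proof.
move=> uQ c0 r24 br2 Qb hz; apply/eqP => mv0.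
pose r3 := (r2 + r4) / 2.
have r23 : r2 < r3 by rewrite /r3; lra.
have r34 : r3 < r4 by rewrite /r3; lra.
(* [phi] is 0 at [b] and, by [hz], positive where the sphere meets the subspace cut out by the forms
   from [j] on; [psi] penalizes leaving that subspace. *)
pose phi x := c * v x + (dotp (- y) x + (dotp y b - c * v b)).
have phiE x : phi x = c * v x - c * v b - dotp y (x - b).
  by rewrite /phi dotpNl dotpBr; ring.
pose gj (l : 'I_n) : 'rV[R]_n -> R :=
  if (l < j)%N then fun=> 0 else abs_affine (col_form Q l) 0.
pose psi x := \sum_l gj l x.
have cgj l : convex_fun (gj l).
  by rewrite /gj; case: ifP => _; [exact: convex_cst|exact: convex_abs_affine].
have gj0 l x : 0 <= gj l x.
  by rewrite /gj; case: ifP => // _; exact: normr_ge0.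
have cphi : convex_fun phi.
  by apply: convex_add; [exact: convex_scale (ltW c0) cv|exact: convex_affine].
have cpsi : convex_fun psi by exact: convex_sum.
pose S := [set z | `|z - x0| = r2].
have clS : closed S.
  rewrite (_ : S = (fun z => `|z - x0|) @^-1` [set r2]) //.
  apply: closed_comp; last exact: closed_eq.
  by move=> z _; exact: (convex_continuous (convex_dist x0)).
have cS : compact S.
  apply: bounded_closed_compact => //.
  exists (r2 + `|x0|); split; first exact: num_real.
  move=> C hC z zr; apply: le_trans (ltW hC).
  by apply: le_norm_center; rewrite zr.
have [|z zr psiz|s [e [s0 e0 he]]] :=
  @compact_penalty _ _ S phi psi cS clS cphi cpsi.
- by move=> z; apply: sumr_ge0.
- have := hz z zr; rewrite phiE => h;
  suff : c * v b + dotp y (z - b) < c * v z by lra.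
  apply: h => l jl; move/eqP: psiz; rewrite /psi psumr_eq0 // => /allP /(_ l).
  rewrite mem_index_enum => /(_ isT) /=;
    rewrite /gj ltnNge jl /= /abs_affine addr0.
  by rewrite normr_eq0 => /eqP.
pose Phi x := 1 * phi x + s * psi x.
have cPhi : convex_fun Phi by apply: convex_add; apply: convex_scale.
have PhiE x : Phi x = phi x + s * psi x by rewrite /Phi mul1r.
have Phib : Phi b = 0.
  rewrite PhiE phiE !subrr dotp0r subrr add0r /psi big1 ?mulr0 // => l _.
  rewrite /gj; case: ltnP => // jl.
  by rewrite /abs_affine Qb // addr0 normr0.
pose G (l : 'I_n) := abs_affine (col_form Q l) (- dotp (col_form Q l) b).
have GE l x : G l x = `|dotp (col_form Q l) (x - b)| by rewrite /G /abs_affine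
  dotpBr.
have cG l : convex_fun (G l) by exact: convex_abs_affine.
pose g x := \sum_l G l x.
have cg : convex_fun g by exact: convex_sum.
have [C C0 hC] := convex_bounded (r2 + `|x0|) cg.
(* On the sphere [k = eps + d * g] stays below [e <= Phi], while at [b] it is [eps > 0 = Phi b]: the
   maximum [u] is the cone [k] near [b] and [Phi] far out. *)
pose eps := e / 2; pose d := e / (2 * (C + 1)).
have C1 : 0 < 2 * (C + 1) by lra.
have eps0 : 0 < eps by rewrite /eps; lra.
have d0 : 0 < d by rewrite divr_gt0.
have dC : d * C <= e / 2.
  rewrite /d mulrAC ler_pdivrMr //.
  by rewrite (_ : e / 2 * (2 * (C + 1)) = e * (C + 1)); [rewrite ler_pM2l //;
    lra|field].
pose k x := d * g x + (dotp 0 x + eps).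
have kE x : k x = eps + d * g x by rewrite /k dotp0l add0r addrC.
have ck : convex_fun k.
  by apply: convex_add; [exact: convex_scale (ltW d0) cg|exact: convex_affine].
pose u x := Num.max (Phi x) (k x).
have cu : convex_fun u by exact: convex_max.
have uPhi x : r2 <= `|x - x0| -> u x = Phi x.
  move=> xr; apply/max_idPl.
  (* Along the ray from [b] through the point [z] of the sphere, [g] is linear and the convex [Phi],
     zero at [b], grows at least linearly; the inequality at [z] thus persists beyond it. *)
  have [t /andP[t0 t1] tr] := segment_meets_sphere br2 xr.
  set z := b + t *: (x - b) in tr.
  have zE : z = t *: x + (1 - t) *: b by apply/rowP => i; rewrite !mxE; ring.
  have h1 := cPhi x b t (ltW t0) t1; rewrite -zE Phib mulr0 addr0 in h1.
  have h2 := he z tr; rewrite -PhiE in h2.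
  have gz : g z = t * g x.
    rewrite /g mulr_sumr; apply: eq_bigr => l _; rewrite !GE.
    by rewrite /z addrAC subrr add0r dotpZr normrM gtr0_norm.
  have zr2 : `|z - x0| <= r2 by rewrite tr.
  have := hC z (le_norm_center zr2).
  rewrite ger0_norm; last by apply: sumr_ge0 => l _; rewrite GE.
  move=> h3; have h4 : d * g z <= d * C by rewrite ler_pM2l.
  rewrite kE -(ler_pM2l t0) mulrDr.
  have h5 : t * eps <= eps by rewrite ler_piMl // ltW.
  have h6 : t * (d * g x) = d * g z by rewrite gz mulrCA.
  by rewrite h6; apply: le_trans h1; apply: le_trans h2; rewrite /eps in h5 *;
    lra.
pose fam (f : 'rV[R]_n -> R) : family := fun l =>
  if (l < j)%N then f else abs_affine (col_form Q l) 0.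
have cfam f : convex_fun f -> convex_family (fam f).
  by move=> cf l; rewrite /fam; case: ifP => // _; exact: convex_abs_affine.
have mPhi : mixed (fam Phi) (oball x0 r3) = 0.
  apply: (mixed_chain n_gt0 HM (cfam _ cv) (cfam _ cPhi) r34 _ mv0).
  move=> w i t t' cw hw wi tt' w0.
  have bB : bounded_borel (oball x0 t) by exact: oball_borel.
  have {}w0 : mixed w (oball x0 t) = 0.
    apply: (mixed_sub0 n_gt0 HM cw _ _ _ w0); try exact: oball_borel.
    by move=> x; rewrite /oball /= => /lt_trans; apply.
  rewrite /fam; case: ltnP => ij; last first.
    by rewrite (_ : upd _ _ _ = w) // -[RHS](upd_id w i) wi /fam ltnNge ij.
  (* Each nonzero penalty form [gj l] already occurs as the entry [l], so its contribution is zero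
     by [mixed_repeat0]. *)
  rewrite (mixed_upd_lin n_gt0 HM) ?ler01 // mul1r.
  rewrite [X in X + _](_ : _ = 0) ?[X in _ * X](_ : _ = 0) ?mulr0 ?addr0 //.
    apply: (mixed_upd_sum0 n_gt0 HM) => // l.
    rewrite /gj; case: ltnP => jl; first exact: mixed_upd0.
    have li : l != i by apply: contraTneq ij => <-; rewrite -leqNgt.
    apply: (@mixed_repeat0 _ _ n_gt0 _ HM _ i l _ _ (col_form Q l) 0).
    - by apply: convex_upd => //; exact: convex_abs_affine.
    - by rewrite eq_sym.
    - by rewrite /upd eqxx.
    - by rewrite /upd (negPf li); case: (hw l) => ->; rewrite /fam ltnNge jl.
  have -> : mixed (upd w i phi) (oball x0 t) =
            mixed (upd w i (fun x => c * v x + 0 * v x)) (oball x0 t).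
    apply: (@mixed_local _ _ n_gt0 _ HM _ _ _ (t + `|x0|)).
    - exact: convex_upd.
    - apply: convex_upd => //; apply: convex_add; apply: convex_scale => //.
      exact: ltW.
    - exact: open_oball.
    - by move=> x xr; exact/le_norm_center/ltW.
    move=> l; rewrite /upd; case: ifP => _.
      by exists (- y), (dotp y b - c * v b) => x _; rewrite mul0r addr0.
    by exists 0, 0 => x _; rewrite dotp0l !addr0.
  rewrite (mixed_upd_lin n_gt0 HM) ?(ltW c0) // mul0r addr0.
  rewrite (_ : upd w i v = w) ?w0 ?mulr0 //.
  by rewrite -[RHS](upd_id w i) wi /fam ij.
have mu0 : mixed (fam u) (oball x0 r3) = 0.
  rewrite -mPhi; apply: (mixed_shell n_gt0 HM _ _ r23);
    [exact: cfam|exact: cfam|].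
  by move=> l x /andP[x2 _]; rewrite /fam; case: ifP => // _; exact: uPhi.
have [rho rho0 hrho] : exists2 rho, 0 < rho &
    forall x, `|x - b| < rho -> `|x - x0| < r3 /\ Phi x < eps.
  apply: (@open_dist _ _ [set x | `|x - x0| < r3 /\ Phi x < eps]) => /=.
    rewrite (_ : [set _ | _] = oball x0 r3 `&` (Phi @^-1` [set t | t < eps]))
      //.
    apply: openI; first exact: open_oball.
    apply: open_comp; last exact: open_lt.
    by move=> x _; exact: convex_continuous.
  by rewrite Phib; split=> //; exact: lt_trans r23.
have uk x : oball b rho x -> u x = k x.
  move=> /hrho[_ h]; apply/max_idPr; apply: le_trans (ltW h) _.
  by rewrite kE lerDl pmulr_rge0 // sumr_ge0 // => l _; rewrite GE.
have cdg : convex_fun (fun x => d * g x) by apply: convex_scale => //;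
  exact: ltW.
have mg0 : mixed (fam (fun x => d * g x)) (oball b rho) = 0.
  rewrite -(@mixed_local _ _ n_gt0 _ HM (fam u) _ _ (rho + `|b|)).
  - apply: (mixed_sub0 n_gt0 HM _ _ _ _ mu0); try exact: oball_borel.
      exact: cfam.
    by move=> x /hrho[].
  - exact: cfam.
  - exact: cfam.
  - exact: open_oball.
  - by move=> x xr; exact/le_norm_center/ltW.
  move=> l; rewrite /fam; case: ifP => _.
    by exists 0, eps => x /uk ->.
  by exists 0, 0 => x _; rewrite dotp0l !addr0.
have rho2 : rho / 2 < rho by lra.
have := mixed_basis_neq0 b uQ (_ : 0 < rho / 2); rewrite -/G => /(_ _)/negP.
apply; first by lra.
apply/eqP.
apply: (mixed_chain n_gt0 HM (cfam _ cdg) cG rho2 _ mg0).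
move=> w i t t' cw hw wi tt' w0.
have {}w0 : mixed w (oball b t) = 0.
  apply: (mixed_sub0 n_gt0 HM cw _ _ _ w0); try exact: oball_borel.
  by move=> x; rewrite /oball /= => /lt_trans; apply.
(* From [j] on the forms vanish at [b], so the entry is [G i] already; before [j], [d * G i] is a
   summand of the entry [d * g]. *)
have [ij|ji] := ltnP i j; last first.
  rewrite (_ : upd _ _ _ = w) // -[RHS](upd_id w i) wi /fam ltnNge ji /=.
  by rewrite /G Qb // oppr0.
apply: (@mixed_upd_summand0 _ _ n_gt0 _ HM w i _ _
  (fun x => \sum_(l | l != i) G l x) d d) => //.
- exact: oball_borel.
- exact: convex_sum.
- exact: ltW.
rewrite -[RHS]w0 -[w in RHS](upd_id w i) wi /fam ij.
congr (mixed (upd _ _ _) _); apply/funext => x.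
by rewrite -mulrDr /g [in RHS](bigD1 i).
Qed.

End Localization.

Theorem theorem1p4 (R : realType) (n j k : nat)
  (hj : (1 <= j)%N) (hjk : (j <= k)%N) (hkn : (k <= n)%N)
  (M : ('I_n -> 'rV[R]_n -> R) -> {measure set borelRV R n -> \bar R})
  (HM : is_mixed_MA M)
  (v : 'rV[R]_n -> R) (hv : convex_fun v) :
  supp (M (rep_ball k v)) `<=` supp (M (rep_ball j v)).
Proof.
have n_gt0 : (0 < n)%N := leq_trans hj (leq_trans hjk hkn).
move=> x0 hk U oU Ux.
rewrite lt_neqAle measure_ge0 andbT eq_sym; apply/eqP => U0.
have [r r0 rU] := open_dist oU Ux.
have mj0 : mixed M (rep_ball j v) (oball x0 r) = 0.
  apply/eqP; rewrite eq_le (mixed_ge0 M) andbT -lee_fin.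
  rewrite -(mixedE n_gt0 HM (convex_rep_ball hv j) (oball_borel x0 r)).
  apply: (@le_trans _ _ (M (rep_ball j v) U)); last by rewrite U0.
  apply: le_measure; rewrite ?inE //.
  - by case: (oball_borel x0 r).
  - exact: sub_sigma_algebra.
(* Positivity moves outwards by one fifth of [r] at a time: norms become forms, contact is isolated
   by a sphere, [v] is modified, and forms become norms again, against [mj0]. *)
have mk : mixed M (rep_ball k v) (oball x0 (r / 5)) != 0.
  have r5 : 0 < r / 5 by lra.
  have := hk _ (@open_oball _ _ x0 (r / 5)).
  rewrite (mixedE n_gt0 HM (convex_rep_ball hv k) (oball_borel x0 (r / 5))).
  by rewrite lte_fin lt0r => /(_ _)/andP[]//; rewrite /oball /= subrr normr0.
have r12 : r / 5 < r * 2 / 5 by lra.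
have [f mf] : exists f, mixed M (abs_family v k f) (oball x0 (r * 2 / 5)) != 0.
  apply: contrapT => h; case/eqP: mk.
  apply: (ball_of_abs_family n_gt0 HM hv r12) => f.
  by apply/eqP/negPn/negP => mf; apply: h; exists f.
have r23 : r * 2 / 5 <= r * 3 / 5 by lra.
have [b [y [br fb hy]]] := exposed_point n_gt0 HM hv r23 mf.
(* With the columns before [k] set to zero, the left kernel of [A] is [forms_kernel k f]. *)
pose A : 'M[R]_n := \matrix_(i, l) if (l < k)%N then 0 else f l ord0 i.
have AE z (l : 'I_n) : (z *m A) ord0 l = if (l < k)%N then 0 else dotp (f l) z.
  rewrite mxE; case: ifP => lk.
    by apply: big1 => i _; rewrite mxE lk mulr0.
  by apply: eq_bigr => i _; rewrite mxE lk mulrC.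
have [i l lk||Q uQ [Qb QA]] := adapted_basis (A := A) (b := b) hj hjk hkn.
- by rewrite mxE lk.
- apply/rowP => l; rewrite AE mxE; case: ltnP => // kl; exact: fb.
have sumE z : \sum_(l < n | (l < k)%N) v z = (\sum_(l < n | (l < k)%N) 1) * v z.
  by rewrite mulr_suml; apply: eq_bigr => l _; rewrite mul1r.
have c0 : 0 < \sum_(l < n | (l < k)%N) 1 :> R.
  rewrite (bigD1 (Ordinal n_gt0)) /=; last exact: leq_trans hjk.
  by rewrite ltr_pwDl // sumr_ge0.
have r24 : r * 3 / 5 < r * 4 / 5 by lra.
have r4 : r * 4 / 5 < r by lra.
have br2 : `|b - x0| < r * 3 / 5 by apply: lt_le_trans r23.
have /eqP[] : mixed M (abs_family v j (col_form Q)) (oball x0 (r * 4 / 5)) != 0.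
  apply: (exposed_mixed_neq0 n_gt0 HM hv uQ c0 r24 br2 (y := y)) =>
    [l jl|z zr hz].
    by rewrite dotp_col_form Qb.
  rewrite -!sumE; apply: hy => // l kl.
  have /rowP/(_ l) : z *m A = 0 by apply: QA => m jm; rewrite -dotp_col_form hz.
  by rewrite AE ltnNge kl /= mxE.
exact: (abs_family_of_ball n_gt0 HM hv _ r4 mj0).
Qed.
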